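(* Each of the problems ICS-Enum, ACS-Enum and MIB-Gen, restricted to acyclic convex geometries admitting an acyclic implicational base of height $2$, is at least as hard as MIS-Enum (and hence MHS-Enum): there are polynomial-time transformations of Sperner hypergraphs into instances of each of these restricted problems such that any algorithm for the restricted problem yields an algorithm for MIS-Enum (resp. MHS-Enum) with the same time complexity up to polynomial overhead.
   Context: A hypergraph $\mathcal{H}=(V,\mathcal{E})$ is Sperner if its edges are pairwise incomparable. $\mathrm{MIS}(\mathcal{H})$ is the family of inclusion-maximal $I\subseteq V$ containing no edge, $\mathrm{MHS}(\mathcal{H})$ the family of inclusion-minimal sets meeting every edge. MIS-Enum (resp. MHS-Enum): given a Sperner hypergraph $\mathcal{H}$, list $\mathrm{MIS}(\mathcal{H})$ (resp. $\mathrm{MHS}(\mathcal{H})$). A closure system on a finite set $X$ is a family $\mathcal{C}\subseteq2^X$ with $X,\emptyset\in\mathcal{C}$, closed under intersection. An implicational base (IB) $(X,\Sigma)$ is a set of implications $A\to B$ ($A,B\subseteq X$ disjoint); its closed sets are the $C\subseteq X$ with $A\subseteq C\Rightarrow B\subseteq C$ for all $A\to B\in\Sigma$, forming the closure system it represents. For $x\in X$, $\mathrm{irr}(x)$ is the family of inclusion-maximal closed sets not containing $x$; $\mathrm{irr}(\mathcal{C})=\bigcup_x\mathrm{irr}(x)$. The implication graph $G(\Sigma)$ has an arc $ab$ whenever $a\in A,b\in B$ for some $A\to B\in\Sigma$; $\Sigma$ is acyclic if $G(\Sigma)$ is, and has height $2$ if moreover $G(\Sigma)$ has no directed path with two arcs.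 A closure system is an acyclic convex geometry if it has an acyclic IB. An IB is unit if all conclusions are singletons, and unit-minimum if it has the fewest implications among equivalent unit IBs. ICS-Enum: given an IB, list $\mathrm{irr}(\mathcal{C})$. ACS-Enum: given an IB and $x\in X$, list $\mathrm{irr}(x)$. MIB-Gen: given $X$ and $\mathrm{irr}(\mathcal{C})$, output a unit-minimum IB of $(X,\mathcal{C})$. *)

(* Defs.v *)
From HB Require Import structures.
From mathcomp Require Import all_boot all_order all_algebra.

Set Implicit Arguments.
Unset Strict Implicit.
Unset Printing Implicit Defensive.

(** * Hypergraphs *)

Definition sperner (T : finType) (H : {set {set T}}) : Prop :=
  forall E F, E \in H -> F \in H -> E \subset F -> E = F.

Definition independent (T : finType) (H : {set {set T}}) (I : {set T}) : bool :=
  [forall E in H, ~~ (E \subset I)].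

Definition hitting (T : finType) (H : {set {set T}}) (A : {set T}) : bool :=
  [forall E in H, A :&: E != set0].

Definition MIS (T : finType) (H : {set {set T}}) : {set {set T}} :=
  [set I : {set T} | maxset (independent H) I].

Definition MHS (T : finType) (H : {set {set T}}) : {set {set T}} :=
  [set A : {set T} | minset (hitting H) A].

(** * Closure systems and implicational bases *)

Definition closure_system (T : finType) (C : {set {set T}}) : Prop :=
  [/\ [set: T] \in C, set0 \in C & {in C &, forall A B, A :&: B \in C}].

Definition irr_at (T : finType) (C : {set {set T}}) (x : T) : {set {set T}} :=
  [set M : {set T} | maxset (fun A : {set T} => (A \in C) && (x \notin A)) M].

Definition irr (T : finType) (C : {set {set T}}) : {set {set T}} :=
  \bigcup_x irr_at C x.

(* The pair [(A, B)] stands for the implication A -> B. *)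
Definition implication (T : finType) : finType := ({set T} * {set T})%type.

Definition ib (T : finType) (S : {set implication T}) : Prop :=
  forall i, i \in S -> [disjoint i.1 & i.2].

Definition closed_sets (T : finType) (S : {set implication T}) : {set {set T}} :=
  [set C : {set T} | [forall i in S, (i.1 \subset C) ==> (i.2 \subset C)]].

(* [closure_system C] is not automatic: it rules out the implications
   [set0 -> B] with [B] nonempty, as the empty set has to be closed. *)
Definition represents (T : finType) (S : {set implication T})
    (C : {set {set T}}) : Prop :=
  [/\ ib S, closure_system C & closed_sets S = C].

Definition imp_arc (T : finType) (S : {set implication T}) : rel T :=
  fun a b => [exists i in S, (a \in i.1) && (b \in i.2)].

Definition acyclic (T : finType) (S : {set implication T}) : Prop :=
  forall c, ucycle (imp_arc S) c -> c = [::].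

Definition acyclic_height2 (T : finType) (S : {set implication T}) : Prop :=
  acyclic S /\ forall a b c, ~ (imp_arc S a b /\ imp_arc S b c).

Definition acyclic_convex_geometry (T : finType) (C : {set {set T}}) : Prop :=
  exists S, represents S C /\ acyclic S.

Definition height2_geometry (T : finType) (C : {set {set T}}) : Prop :=
  acyclic_convex_geometry C /\ exists S, represents S C /\ acyclic_height2 S.

Definition unit_ib (T : finType) (S : {set implication T}) : Prop :=
  ib S /\ forall i, i \in S -> exists b, i.2 = [set b].

Definition unit_minimum (T : finType) (S : {set implication T}) : Prop :=
  unit_ib S /\
  forall S' : {set implication T},
    unit_ib S' -> closed_sets S' = closed_sets S -> #|S| <= #|S'|.

(** * Model of computation

    A variable-free form of Jones's WHILE language: programs compute partial
    functions on binary trees. Every elementary step is charged the number of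
    nodes of the tree it handles, so that neither the input nor the output can
    be larger than the running time, and running times agree with those of
    Turing machines up to a polynomial. *)

Inductive data := Nil | Cons of data & data.

Fixpoint dsize (d : data) : nat :=
  if d is Cons a b then (dsize a + dsize b).+1 else 1.

Definition hd (d : data) : data := if d is Cons a _ then a else Nil.
Definition tl (d : data) : data := if d is Cons _ b then b else Nil.

Inductive prog :=
  | PId
  | PNil
  | PHd
  | PTl
  | PPair of prog & prog
  | PSeq of prog & prog
  | PIf of prog & prog & prog
  | PWhile of prog & prog.

(* [eval p x y t]: on input [x], the program [p] halts in time [t] with output
   [y]. In tests, [Nil] is false and every other tree is true. *)
Inductive eval : prog -> data -> data -> nat -> Prop :=
  | EId x : eval PId x x (dsize x)
  | ENil x : eval PNil x Nil (dsize x)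
  | EHd x : eval PHd x (hd x) (dsize x)
  | ETl x : eval PTl x (tl x) (dsize x)
  | EPair p q x y z t u :
      eval p x y t -> eval q x z u ->
      eval (PPair p q) x (Cons y z) (dsize x + t + u)
  | ESeq p q x y z t u :
      eval p x y t -> eval q y z u -> eval (PSeq p q) x z (t + u)
  | EIfTrue c p q x a b y t u :
      eval c x (Cons a b) t -> eval p x y u ->
      eval (PIf c p q) x y (dsize x + t + u)
  | EIfFalse c p q x y t u :
      eval c x Nil t -> eval q x y u ->
      eval (PIf c p q) x y (dsize x + t + u)
  | EWhileTrue c p x a b y z t u v :
      eval c x (Cons a b) t -> eval p x y u -> eval (PWhile c p) y z v ->
      eval (PWhile c p) x z (dsize x + t + u + v)
  | EWhileFalse c p x t :
      eval c x Nil t -> eval (PWhile c p) x x (dsize x + t).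

Lemma eval_det p x y y' t t' : eval p x y t -> eval p x y' t' -> y = y' /\ t = t'.
Proof.
move=> e; elim: e y' t' => {p x y t} /= *;
  match goal with e : eval _ _ ?y ?t |- _ = ?y /\ _ = ?t => inversion e end; subst;
  repeat match goal with
  | IH : forall y t, eval ?p ?x y t -> _ /\ _, e : eval ?p ?x _ _ |- _ =>
    case: (IH _ _ e) => ??; clear IH; subst; try discriminate
  end; by [].
Qed.

Lemma eval_dsize p x y t : eval p x y t -> dsize x <= t /\ dsize y <= t.
Proof.
have pos d : 0 < dsize d by case: d.
move=> e; elim: e => {p x y t} //=.
- by case=> //= a b; split=> //; rewrite leqW ?leq_addr.
- by case=> //= a b; split=> //; rewrite leqW ?leq_addl.
- move=> p q x y z t u _ [_ yt] _ [_ zu]; split.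
    by rewrite -addnA leq_addr.
  by rewrite -addnA -[X in X <= _]add1n leq_add ?leq_add.
- move=> p q x y z t u _ [xt _] _ [_ zu].
  by split; [apply: leq_trans xt (leq_addr _ _) | apply: leq_trans zu (leq_addl _ _)].
- move=> c p q x a b y t u _ _ _ [_ yu].
  by split; [rewrite -addnA leq_addr | apply: leq_trans yu (leq_addl _ _)].
- move=> c p q x y t u _ _ _ [_ yu].
  by split; [rewrite -addnA leq_addr | apply: leq_trans yu (leq_addl _ _)].
- move=> c p x a b y z t u v _ _ _ _ _ [_ zv].
  by split; [rewrite -!addnA leq_addr | apply: leq_trans zv (leq_addl _ _)].
- by move=> c p x t _ _; rewrite leq_addr.
Qed.

(** * Encodings

    The ground set is ['I_n]; numbers are written in unary and subsets of
    ['I_n] as bit vectors of length [n]. *)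

Definition enc_list (U : Type) (f : U -> data) (s : seq U) : data :=
  foldr (fun u d => Cons (f u) d) Nil s.

Definition enc_nat (k : nat) : data := iter k (Cons Nil) Nil.

Definition enc_bool (b : bool) : data := if b then Cons Nil Nil else Nil.

Definition enc_set (n : nat) (A : {set 'I_n}) : data :=
  enc_list (fun i => enc_bool (i \in A)) (enum 'I_n).

Definition enc_imp (n : nat) (i : implication 'I_n) : data :=
  Cons (enc_set i.1) (enc_set i.2).

(* [d] lists the elements of the family [F], in any order, without repetition. *)
Definition lists (U : finType) (f : U -> data) (F : {set U}) (d : data) : Prop :=
  exists s : seq U, perm_eq s (enum F) /\ d = enc_list f s.

(** * Problems *)

(* [code I x]: the tree [x] is an encoding of the instance [I] (which has
   several encodings, as families can be listed in any order).
   [answer I y]: the tree [y] is a correct output for [I]. *)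
Record problem := Problem {
  instance : Type;
  valid : instance -> Prop;
  code : instance -> data -> Prop;
  answer : instance -> data -> Prop }.

Definition restrict (P : problem) (K : instance P -> Prop) : problem :=
  Problem (fun I => valid I /\ K I) (@code P) (@answer P).

Definition code_hypergraph (n : nat) (H : {set {set 'I_n}}) (x : data) : Prop :=
  exists l, lists (@enc_set n) H l /\ x = Cons (enc_nat n) l.

Definition code_ib (n : nat) (S : {set implication 'I_n}) (x : data) : Prop :=
  exists l, lists (@enc_imp n) S l /\ x = Cons (enc_nat n) l.

Definition MIS_Enum : problem := @Problem
  {n : nat & {set {set 'I_n}}}
  (fun I => sperner (tagged I))
  (fun I x => code_hypergraph (tagged I) x)
  (fun I y => lists (@enc_set _) (MIS (tagged I)) y).

Definition MHS_Enum : problem := @Problem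
  {n : nat & {set {set 'I_n}}}
  (fun I => sperner (tagged I))
  (fun I x => code_hypergraph (tagged I) x)
  (fun I y => lists (@enc_set _) (MHS (tagged I)) y).

Definition ICS_Enum : problem := @Problem
  {n : nat & {set implication 'I_n}}
  (fun I => represents (tagged I) (closed_sets (tagged I)))
  (fun I x => code_ib (tagged I) x)
  (fun I y => lists (@enc_set _) (irr (closed_sets (tagged I))) y).

Definition ACS_Enum : problem := @Problem
  {n : nat & ({set implication 'I_n} * 'I_n)%type}
  (fun I => represents (tagged I).1 (closed_sets (tagged I).1))
  (fun I x => exists d, code_ib (tagged I).1 d /\
                        x = Cons (enc_nat (tagged I).2) d)
  (fun I y => lists (@enc_set _)
                (irr_at (closed_sets (tagged I).1) (tagged I).2) y).

(* An instance is a closure system, given through its irreducible sets. *)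
Definition MIB_Gen : problem := @Problem
  {n : nat & {set {set 'I_n}}}
  (fun I => closure_system (tagged I))
  (fun I x => code_hypergraph (irr (tagged I)) x)
  (fun I y => exists S, [/\ represents S (tagged I), unit_minimum S
                          & lists (@enc_imp _) S y]).

Definition ICS_Enum_height2 : problem := @restrict ICS_Enum
  (fun I => height2_geometry (closed_sets (tagged I))).

Definition ACS_Enum_height2 : problem := @restrict ACS_Enum
  (fun I => height2_geometry (closed_sets (tagged I).1)).

Definition MIB_Gen_height2 : problem := @restrict MIB_Gen
  (fun I => height2_geometry (tagged I)).

(** * Reductions *)

Definition solves (A : prog) (P : problem) : Prop :=
  forall (I : instance P) x, valid I -> code I x ->
  exists y t, eval A x y t /\ answer I y.

Definition transforms (f : prog) (q : {poly nat}) (P Q : problem) : Prop :=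
  forall (I : instance P) x, valid I -> code I x ->
  exists (J : instance Q) x' t,
    [/\ valid J, code J x', eval f x x' t & t <= q.[dsize x]%R].

(* On input [x], the algorithm [B] takes at most the time [t'] of [A] on the
   transformed input [x'], plus a polynomial in [N], the size of [x] and of the
   output [y] of [B]; the output [y'] of [A] has size polynomial in [N] as well.
   Hence a bound [T n m] on the running time of [A] for inputs of size [n] and
   outputs of size [m], nondecreasing in [n] and [m], yields for [B] the bound
   [T q.[N] q.[N] + q.[N]]. *)
Definition same_time_up_to_poly (f A B : prog) (q : {poly nat})
    (P : problem) : Prop :=
  forall (I : instance P) x, valid I -> code I x ->
  exists x' y' y u t' t,
    [/\ eval f x x' u, eval A x' y' t', eval B x y t,
        dsize y' <= q.[(dsize x + dsize y)%N]%R
      & t <= t' + q.[(dsize x + dsize y)%N]%R].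

Definition at_least_as_hard (Q P : problem) : Prop :=
  exists (f : prog) (q : {poly nat}),
    transforms f q P Q /\
    forall A, solves A Q ->
    exists B, solves B P /\ same_time_up_to_poly f A B q P.

(* Main.v *)
From mathcomp Require Import all_boot all_order all_algebra zify.
Require Import Defs.

Set Implicit Arguments.
Unset Strict Implicit.
Unset Printing Implicit Defensive.

(** All the closure systems used have a single implied point [z]: every set
    containing [z] is closed, and the sets avoiding [z] that are closed form a
    down-set [D]. The irreducible sets are then the maximal members of [D] and the
    complements of the points other than [z], while the only unit-minimum base
    consists of the implications [A -> z] with [A] minimal outside [D].

    For ICS-Enum and ACS-Enum, [D] is the family of independent sets of [H]: the
    given base is [E -> z] for the edges [E], and the irreducible sets avoiding
    [z] are the maximal independent sets. For MIB-Gen, [D] is the family of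
    non-transversals: the irreducible sets avoiding [z] are the complements of the
    edges, and the premises of the unit-minimum base are the minimal transversals.
    One or two auxiliary points absorb the degenerate cases [H = set0] and
    [set0 \in H]. Minimal transversals and maximal independent sets are complements
    of each other. The reductions only use loops over lists, and what they read
    back is a filter of the output by its first bits. *)

(** * Subsets of ['I_n.+1] *)

(** The added point comes first, so that the bit vector of [ext b A] is [b :: bits A] and programs
    reach the auxiliary points with a few [PHd] and [PTl]. *)
Definition ext n (b : bool) (A : {set 'I_n}) : {set 'I_n.+1} :=
  [set i | if unlift ord0 i is Some j then j \in A else b].

Definition rest n (C : {set 'I_n.+1}) : {set 'I_n} := [set j | lift ord0 j \in C].

Lemma in_ext0 n b (A : {set 'I_n}) : (ord0 \in ext b A) = b.
Proof. by rewrite inE unlift_none. Qed.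

Lemma in_ext_lift n b (A : {set 'I_n}) j : (lift ord0 j \in ext b A) = (j \in A).
Proof. by rewrite inE liftK. Qed.

Lemma rest_ext n b (A : {set 'I_n}) : rest (ext b A) = A.
Proof. by apply/setP=> j; rewrite inE in_ext_lift. Qed.

Lemma ext_rest n (C : {set 'I_n.+1}) : ext (ord0 \in C) (rest C) = C.
Proof. by apply/setP=> i; rewrite inE; case: unliftP => [j|] ->; rewrite ?inE. Qed.

Variant ext_spec n : {set 'I_n.+1} -> Prop :=
  ExtSpec b (A : {set 'I_n}) : ext_spec (ext b A).

Lemma extP n (C : {set 'I_n.+1}) : ext_spec C.
Proof. by rewrite -(ext_rest C). Qed.

Lemma ext_sub n b c (A B : {set 'I_n}) :
  (ext b A \subset ext c B) = (b ==> c) && (A \subset B).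
Proof.
apply/subsetP/andP => [sAB|[bc /subsetP sAB] i]; last first.
  by case: (unliftP ord0 i) => [j|] ->; rewrite ?in_ext_lift ?in_ext0 //;
    [apply: sAB | apply/implyP].
split; first by have := sAB ord0; rewrite !in_ext0 => /implyP.
by apply/subsetP=> j; have := sAB (lift ord0 j); rewrite !in_ext_lift.
Qed.

Lemma ext_inj n b c (A B : {set 'I_n}) : ext b A = ext c B -> b = c /\ A = B.
Proof.
by move=> eAB; split; [rewrite -(in_ext0 b A) eAB in_ext0 | rewrite -(rest_ext b A) eAB rest_ext].
Qed.

Lemma ext_injr n b : injective (@ext n b).
Proof. by move=> A B /ext_inj[]. Qed.

Lemma ext_setT n : ext true [set: 'I_n] = setT.
Proof. by rewrite -[RHS]ext_rest inE; congr ext; apply/setP=> j; rewrite !inE. Qed.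

Lemma ext_set0 n : ext false (set0 : {set 'I_n}) = set0.
Proof. by rewrite -[RHS]ext_rest inE; congr ext; apply/setP=> j; rewrite !inE. Qed.

Lemma ext_setI n b c (A B : {set 'I_n}) : ext b A :&: ext c B = ext (b && c) (A :&: B).
Proof.
by rewrite -[LHS]ext_rest in_setI !in_ext0; congr ext;
  apply/setP=> j; rewrite !(inE, in_ext_lift) !liftK.
Qed.

Lemma ext_setC n b (A : {set 'I_n}) : ~: ext b A = ext (~~ b) (~: A).
Proof.
by rewrite -[LHS]ext_rest in_setC !in_ext0; congr ext;
  apply/setP=> j; rewrite !(inE, in_ext_lift) !liftK.
Qed.

Lemma ext_setC1_ord0 n : ext false setT = [set~ ord0] :> {set 'I_n.+1}.
Proof.
by rewrite -[RHS]ext_rest !inE eqxx; congr ext; apply/setP=> j; rewrite !inE eq_sym neq_lift.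
Qed.

Lemma ext_setC1_lift n (v : 'I_n) : ext true [set~ v] = [set~ lift ord0 v].
Proof.
rewrite -[RHS]ext_rest !inE neq_lift; congr ext; apply/setP=> j.
by rewrite !inE (inj_eq (@lift_inj _ _)).
Qed.

(** * Closure systems in which only [ord0] can be implied *)

Section PointSystem.
Variables (n : nat) (D : pred {set 'I_n}).

Definition point_system : {set {set 'I_n.+1}} :=
  [set C : {set 'I_n.+1} | (ord0 \in C) || D (rest C)].

Lemma in_point_system b A : (ext b A \in point_system) = b || D A.
Proof. by rewrite inE in_ext0 rest_ext. Qed.

Hypothesis D_anti : forall A B : {set 'I_n}, A \subset B -> D B -> D A.
Hypothesis D0 : D set0.

Lemma closure_system_point : closure_system point_system.
Proof.
split; first by rewrite -ext_setT in_point_system.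
  by rewrite -ext_set0 in_point_system D0.
move=> A B; case: (extP A) => b {}A; case: (extP B) => c {}B.
rewrite ext_setI !in_point_system.
case: b => /=; case: c => //=; first by move=> _; apply: D_anti; rewrite subsetIr.
  by move=> + _; apply: D_anti; rewrite subsetIl.
by move=> + _; apply: D_anti; rewrite subsetIl.
Qed.

Lemma irr_at_ord0 b A : (ext b A \in irr_at point_system ord0) = ~~ b && maxset D A.
Proof.
rewrite inE; case: b => /=; first by apply/maxsetP; rewrite in_ext0 andbF => -[].
apply/maxsetP/maxsetP; rewrite in_point_system in_ext0 andbT => -[/= DA max]; split=> // B.
  move=> DB sAB; apply: (@ext_injr _ false); apply: max; last by rewrite ext_sub.
  by rewrite in_point_system in_ext0 DB.
case: (extP B) => -[] {}B; rewrite in_point_system in_ext0 ?ext_sub ?andbF //= andbT => DB sAB.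
by rewrite (max B).
Qed.

(** [ext true [set~ v]] is closed because it contains [ord0], and it is the greatest set avoiding
    [lift ord0 v]. *)
Lemma irr_at_lift C (v : 'I_n) :
  (C \in irr_at point_system (lift ord0 v)) = (C == ext true [set~ v]).
Proof.
have sub b (A : {set 'I_n}) : v \notin A -> ext b A \subset ext true [set~ v].
  by move=> vA; rewrite ext_sub implybT -disjoints_subset disjoint_sym disjoints1.
have good : (ext true [set~ v] \in point_system) && (lift ord0 v \notin ext true [set~ v]).
  by rewrite in_point_system in_ext_lift !inE eqxx.
rewrite inE; case: (extP C) => b A; apply/maxsetP/eqP => [[/andP[_]]|->].
  by rewrite in_ext_lift => vA max; rewrite (max (ext true [set~ v])) ?sub.
split=> // B; case: (extP B) => c {}B /andP[_]; rewrite in_ext_lift => vB sB.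
by apply/eqP; rewrite eqEsubset sub // sB.
Qed.

Lemma irr_pointP C :
  reflect ((exists2 A, maxset D A & C = ext false A) \/ (exists v, C = ext true [set~ v]))
    (C \in irr point_system).
Proof.
apply: (iffP bigcupP) => [[x _]|[[A maxA ->]|[v ->]]].
- case: (unliftP ord0 x) => [v|] ->; first by rewrite irr_at_lift => /eqP ->; right; exists v.
  by case: (extP C) => -[] A; rewrite irr_at_ord0 //=; left; exists A.
- by exists ord0; rewrite ?irr_at_ord0.
- by exists (lift ord0 v); rewrite ?irr_at_lift.
Qed.

End PointSystem.

(** * Implicational bases whose only conclusion is [ord0] *)

Section PointBase.
Variable n : nat.
Implicit Types (K : {set {set 'I_n}}) (S : {set implication 'I_n.+1}).

(** The conclusion [ext true set0] is the singleton of [ord0]. *)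
Definition point_imp (A : {set 'I_n}) : implication 'I_n.+1 := (ext false A, ext true set0).

Definition point_base K : {set implication 'I_n.+1} := [set point_imp A | A in K].

Lemma point_imp_inj : injective point_imp.
Proof. by move=> A B [/ext_injr]. Qed.

Lemma disjoint_point_imp A : [disjoint (point_imp A).1 & (point_imp A).2].
Proof. by rewrite -setI_eq0 ext_setI setI0 ext_set0. Qed.

Lemma ib_point_base K : ib (point_base K).
Proof. by move=> i /imsetP[A _ ->]; apply: disjoint_point_imp. Qed.

Lemma independent_anti K (A B : {set 'I_n}) : A \subset B -> independent K B -> independent K A.
Proof.
move=> sAB /forall_inP ind; apply/forall_inP=> E EK.
by apply: contra (ind E EK) => sEA; apply: subset_trans sEA sAB.
Qed.

Lemma closed_point_base K : closed_sets (point_base K) = point_system (independent K).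
Proof.
apply/setP=> C; case: (extP C) => b A; rewrite in_point_system inE.
apply/forall_inP/orP => [cl|[->|/forall_inP ind] _ /imsetP[E EK ->]] /=.
- case: b cl => cl; [by left | right; apply/forall_inP=> E EK; apply/negP=> sEA].
  by have /implyP := cl _ (imset_f point_imp EK); rewrite !ext_sub sEA => /(_ isT).
- by rewrite !ext_sub sub0set !implybT.
- by rewrite !ext_sub (negbTE (ind E EK)).
Qed.

(** The hypothesis [independent K set0] says that no premise is empty, which is what the closedness
    of the empty set requires. *)
Lemma represents_point_base K :
  independent K set0 -> represents (point_base K) (point_system (independent K)).
Proof.
move=> K0; split; [exact: ib_point_base | | exact: closed_point_base].
exact: closure_system_point (@independent_anti K) K0.
Qed.

Lemma arc_point_base K a b : imp_arc (point_base K) a b -> a != ord0 /\ b = ord0.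
Proof.
case/exists_inP=> _ /imsetP[E _ ->] /=; case: (unliftP ord0 a) => [i|] ->; last by rewrite in_ext0.
by case: (unliftP ord0 b) => [j|] -> /andP[]; rewrite ?in_ext_lift ?inE // eq_sym neq_lift.
Qed.

Lemma acyclic_height2_point_base K : acyclic_height2 (point_base K).
Proof.
have no2 a b c : ~ (imp_arc (point_base K) a b /\ imp_arc (point_base K) b c).
  by move=> [/arc_point_base[_ ->] /arc_point_base[]]; rewrite eqxx.
(* A loop at [x] is walked twice, a cycle on two points once; both then give two consecutive
   arcs. *)
split=> // -[|x [|y [|z p]]] // /andP[] /=.
- by rewrite andbT => e _; case: (no2 x x x).
- by rewrite andbT => /andP[e e'] _; case: (no2 x y x).
- by case/and3P=> e e' _ _; case: (no2 x y z).
Qed.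

Lemma height2_geometry_point_base K :
  independent K set0 -> height2_geometry (point_system (independent K)).
Proof.
move=> K0; have rep := represents_point_base K0.
by split; exists (point_base K); split=> //; case: (acyclic_height2_point_base K).
Qed.

Lemma unit_ib_point_base K : unit_ib (point_base K).
Proof.
split; first exact: ib_point_base.
by move=> i /imsetP[A _ ->]; exists ord0; rewrite -[RHS]setCK -ext_setC1_ord0 ext_setC setCT.
Qed.

Variable D : pred {set 'I_n}.
Hypothesis D_anti : forall A B : {set 'I_n}, A \subset B -> D B -> D A.

Definition min_implying : {set {set 'I_n}} := [set A | minset (fun B => ~~ D B) A].

(** By finiteness every set outside [D] contains a minimal one, and a member of [D] contains none
    because [D] is closed under subsets. So every point system has a point base. *)
Lemma independent_min_implying : independent min_implying =1 D.
Proof.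
move=> A; apply/forall_inP/idP => [ind|DA E]; last first.
  by rewrite inE => /minsetp nDE; apply: contra nDE => /D_anti; apply.
apply: contraT => nDA; have [B minB sBA] := @minset_exists _ (fun B => ~~ D B) A nDA.
by have := ind B; rewrite inE minB sBA => /(_ isT).
Qed.

Lemma point_system_min_implying : point_system (independent min_implying) = point_system D.
Proof. by apply/setP=> C; rewrite !inE independent_min_implying. Qed.

(* A unit implication [A -> b] with [b != ord0] is violated by the closed set
   [ord0 |: A]; and a minimal implying set is its own only violated premise. *)
Lemma unit_minimum_point_system S :
  unit_minimum S -> closed_sets S = point_system D -> S = point_base min_implying.
Proof.
case=> -[ibS unitS] minS clS; apply/esym/eqP.
(* Minimality of [S] bounds its size by that of the point base, so it suffices that [S] contains the
   point base. *)
rewrite eqEcard minS; last 2 first.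
- exact: unit_ib_point_base.
- by rewrite closed_point_base point_system_min_implying.
rewrite andbT; apply/subsetP=> _ /imsetP[A minA ->].
have impliesP i : i \in S -> exists2 B, i = point_imp B & ~~ D B.
  case: i => X Y iS; have /= [b bY] := unitS _ iS; have /= := ibS _ iS.
  rewrite {Y}bY disjoint_sym disjoints1 in iS *.
  have valid C : C \in point_system D -> X \subset C -> b \in C.
    rewrite -clS inE => /forall_inP/(_ _ iS)/implyP/=.
    by rewrite sub1set.
  case: (extP X) iS valid => c B iS.
  case: (unliftP ord0 b) => [j|] eb valid; rewrite {}eb in iS valid *.
    rewrite in_ext_lift => jB; have := valid (ext true B).
    by rewrite in_point_system in_ext_lift (negbTE jB) ext_sub implybT subxx => /(_ isT isT).
  rewrite in_ext0 => nc; rewrite (negbTE nc) in valid *; exists B.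
    congr pair; apply: setC_inj; rewrite -ext_setC1_ord0 ext_setC; congr ext.
    by apply/setP=> j; rewrite !inE.
  apply/negP=> DB; have := valid (ext false B).
  by rewrite in_point_system DB in_ext0 subxx => /(_ isT isT).
move: minA; rewrite inE => /minsetP[nDA minA].
have : ext false A \notin closed_sets S by rewrite clS in_point_system.
rewrite inE negb_forall_in => /exists_inP[i iS]; rewrite negb_imply => /andP[+ _].
have [B ei nDB] := impliesP i iS; rewrite ei ext_sub => /= sBA.
by rewrite -(minA B) // -ei.
Qed.

End PointBase.

(** * Encoding a hypergraph by the premises of implications *)

Section Apexed.
Variables (n : nat) (H : {set {set 'I_n}}).

(** A set meets every edge exactly when its complement contains none, and complementation exchanges
    minimal and maximal sets. *)
Lemma MHS_setC A : (A \in MHS H) = (~: A \in MIS H).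
Proof.
have hitE B : hitting H B = independent H (~: B).
  by apply: eq_forallb => E; rewrite subsets_disjoint setCK -setI_eq0 setIC.
rewrite !inE; apply/minsetP/maxsetP; rewrite hitE => -[indA ext]; split=> // B.
  by move=> indB sAB; rewrite -[B]setCK (ext (~: B)) ?hitE ?setCK // -setCS setCK.
by rewrite hitE => indB sBA; apply: setC_inj; rewrite (ext (~: B)) // setCS.
Qed.

(* The apex keeps the premises nonempty even if [set0] is an edge. *)
Definition apexed : {set {set 'I_n.+1}} := [set ext true E | E in H].

Lemma independent_apexed b A : independent apexed (ext b A) = ~~ b || independent H A.
Proof.
apply/forall_inP/orP => [ind|[nb|/forall_inP ind] _ /imsetP[E EH ->]].
- case: b ind => ind; [right; apply/forall_inP=> E EH | by left].
  by have := ind _ (imset_f (ext true) EH); rewrite ext_sub.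
- by rewrite ext_sub (negbTE nb).
- by rewrite ext_sub negb_and (ind E EH) orbT.
Qed.

Lemma independent_apexed0 : independent apexed set0.
Proof. by rewrite -ext_set0 independent_apexed. Qed.

Lemma maxset_apexed_true A : maxset (independent apexed) (ext true A) = (A \in MIS H).
Proof.
rewrite inE; apply/maxsetP/maxsetP; rewrite independent_apexed => -[indA max]; split=> // B.
  by move=> indB sAB; apply: (@ext_injr _ true); apply: max; rewrite ?independent_apexed ?ext_sub.
case: (extP B) => -[] {}B; rewrite independent_apexed ext_sub //= => indB sAB.
by rewrite (max B).
Qed.

(** [ext false setT] is always independent, so it is the only possible maximal set without the
    apex. *)
Lemma maxset_apexed_false A : maxset (independent apexed) (ext false A) -> A = setT.
Proof.
case/maxsetP=> _ max; apply: (@ext_injr _ false); apply/esym/max.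
  by rewrite independent_apexed.
by rewrite ext_sub subsetT.
Qed.

End Apexed.

(** * Encoding a hypergraph by irreducible sets *)

Section Framed.
Variables (n : nat) (H : {set {set 'I_n}}).

(* The sets containing no minimal transversal of the hypergraph with edges
   [{w}] and [u |: E], [E \in H]: it is nonempty and Sperner even if [H] is
   empty or contains [set0]. *)
Definition framed (B : {set 'I_n.+2}) : bool :=
  (ord0 \notin B) || ((ord0 \notin rest B) && ~~ hitting H (rest (rest B))).

Lemma framedE w u A : framed (ext w (ext u A)) = ~~ w || (~~ u && ~~ hitting H A).
Proof. by rewrite /framed !rest_ext !in_ext0. Qed.

Lemma hitting_mono (A B : {set 'I_n}) : A \subset B -> hitting H A -> hitting H B.
Proof.
move=> sAB /forall_inP hit; apply/forall_inP=> E EH.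
by apply: contraNneq (hit E EH) => BE; rewrite -subset0 -BE setSI.
Qed.

Lemma hittingPn (A : {set 'I_n}) : reflect (exists2 E, E \in H & A \subset ~: E) (~~ hitting H A).
Proof.
rewrite negb_forall_in; apply: (iffP exists_inP) => -[E EH AE]; exists E => //.
  by rewrite -disjoints_subset -setI_eq0; rewrite negbK in AE.
by rewrite negbK setI_eq0 disjoints_subset.
Qed.

Lemma framed_anti (A B : {set 'I_n.+2}) : A \subset B -> framed B -> framed A.
Proof.
case: (extP A) => w {}A; case: (extP A) => u {}A.
case: (extP B) => w' {}B; case: (extP B) => u' {}B.
rewrite !ext_sub !framedE => /and3P[ww uu sAB].
case/orP=> [nw|/andP[nu nB]]; first by rewrite (contra (implyP ww)).
by rewrite (contra (implyP uu)) // (contra (hitting_mono sAB)) ?orbT.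
Qed.

Lemma framed0 : framed set0.
Proof. by rewrite -!ext_set0 framedE. Qed.

(** These are the complements of the edges [u |: E] and [{w}]. The Sperner property ensures that no
    complement of an edge lies properly inside another. *)
Lemma maxset_framed w u A : sperner H ->
  maxset framed (ext w (ext u A)) =
  if w then ~~ u && (~: A \in H) else u && (A == setT).
Proof.
move=> spH; case: w.
  apply/maxsetP/andP; rewrite framedE /=.
    case=> /andP[nu /hittingPn[E EH sAE]] max; split=> //.
    suff /ext_injr/ext_inj[_ <-] : ext true (ext u (~: E)) = ext true (ext u A) by rewrite setCK.
    apply: max; last by rewrite !ext_sub !implybb sAE.
    by rewrite framedE nu; apply/hittingPn; exists E.
  case=> nu AH; split; first by rewrite nu; apply/hittingPn; exists (~: A); rewrite ?setCK.
  move=> B; case: (extP B) => w {}B; case: (extP B) => u' {}B.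
  rewrite !ext_sub framedE => + /and3P[/= wT uu sAB]; rewrite wT (negbTE nu) /=.
  case/andP=> /negbTE-> /hittingPn[E EH sBE]; congr (ext _ (ext _ _)).
  (* [A] avoids [E], so [E] lies in the edge [~: A], and incomparability makes the two edges
     equal. *)
  have eE : E = ~: A by apply: spH => //; rewrite -setCS setCK; apply: subset_trans sAB sBE.
  by apply/eqP; rewrite eqEsubset sAB andbT -[A]setCK -eE.
apply/maxsetP/andP => [[_ max]|[uT /eqP->]].
  suff /ext_injr/ext_inj[<- <-] : ext false (ext true setT) = ext false (ext u A) by [].
  by apply: max; rewrite ?framedE // !ext_sub !implybT subsetT.
split; first by rewrite framedE.
move=> B; case: (extP B) => w {}B; case: (extP B) => u' {}B.
rewrite !ext_sub framedE uT /= => + /andP[uu]; by rewrite uu subTset orbF => /negbTE-> /eqP->.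
Qed.

(** Without [u], a transversal has to meet each [u |: E] inside [E], so it consists of [w] and a
    transversal of [H]. *)
Lemma min_implying_framed_false A :
  (ext true (ext false A) \in min_implying framed) = (A \in MHS H).
Proof.
rewrite !inE; apply/minsetP/minsetP; rewrite framedE negbK => -[hitA min]; split=> // B.
  move=> hitB sBA; apply: (@ext_injr _ false); apply: (@ext_injr _ true).
  by apply: min; rewrite ?framedE ?negbK // !ext_sub.
case: (extP B) => -[] {}B; case: (extP B) => -[] {}B;
  rewrite framedE !ext_sub //= negbK => hitB sBA.
by rewrite (min B).
Qed.

(** A transversal always contains [w]; once it contains [u] as well, these two points suffice. This
    leaves at most one spurious premise. *)
Lemma min_implying_framedP B : B \in min_implying framed ->
  B = ext true (ext true set0) \/ exists2 A, A \in MHS H & B = ext true (ext false A).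
Proof.
case: (extP B) => w {}B; case: (extP B) => -[] A minB; last first.
  case: w minB => [|]; last by rewrite inE => /minsetp; rewrite framedE.
  by rewrite min_implying_framed_false; right; exists A.
move: minB; rewrite inE; case/minsetP; rewrite framedE orbF negbK => -> min.
by left; symmetry; apply: min; rewrite ?framedE // !ext_sub sub0set.
Qed.

End Framed.

(** * Polynomial bounds *)

(** The coefficients are natural numbers; monotonicity is what allows bounds to be composed. *)
Lemma horner_nat_mono (q : {poly nat}) m n : m <= n -> q.[m]%R <= q.[n]%R.
Proof.
move=> mn; elim/poly_ind: q => [|q c IH]; first by rewrite !horner0.
by rewrite !hornerMXaddC; apply: leq_add (leq_mul IH mn) (leqnn c).
Qed.

Section PolyTime.
Variables (U : Type) (D : U -> Prop) (N : U -> nat).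
Implicit Types (a b c : U -> data) (p q : prog) (T : U -> nat).

Definition poly_bounded T : Prop :=
  exists q : {poly nat}, forall u, D u -> T u <= q.[N u]%R.

(** Time is measured against [N u] and not against the size of [a u]: a subprogram run inside a loop
    is thus bounded in terms of the whole input, by one polynomial for all indices. *)
Definition poly_time p a b : Prop :=
  exists q : {poly nat}, forall u, D u -> exists2 t, eval p (a u) (b u) t & t <= q.[N u]%R.

Lemma poly_bounded_le T T' : (forall u, D u -> T u <= T' u) -> poly_bounded T' -> poly_bounded T.
Proof. by move=> TT [q bq]; exists q => u Du; apply: leq_trans (TT u Du) (bq u Du). Qed.

Lemma poly_bounded_size : poly_bounded N.
Proof. by exists 'X%R => u _; rewrite hornerX. Qed.

Lemma poly_bounded_const k : poly_bounded (fun=> k).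
Proof. by exists k%:P%R => u _; rewrite hornerC. Qed.

Lemma poly_bounded_add T T' :
  poly_bounded T -> poly_bounded T' -> poly_bounded (fun u => T u + T' u).
Proof.
by move=> [q bq] [q' bq']; exists (q + q')%R => u Du; rewrite hornerD; apply: leq_add; auto.
Qed.

Lemma poly_bounded_mul T T' :
  poly_bounded T -> poly_bounded T' -> poly_bounded (fun u => T u * T' u).
Proof.
by move=> [q bq] [q' bq']; exists (q * q')%R => u Du; rewrite hornerM; apply: leq_mul; auto.
Qed.

Lemma poly_timeE p a b T : poly_bounded T ->
  (forall u, D u -> exists2 t, eval p (a u) (b u) t & t <= T u) -> poly_time p a b.
Proof.
move=> [q bq] ev; exists q => u Du; have [t et tT] := ev u Du.
by exists t => //; apply: leq_trans tT (bq u Du).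
Qed.

(** A running time is never below the size of the input, so time bounds also provide size bounds. *)
Lemma poly_time_in p a b : poly_time p a b -> poly_bounded (fun u => dsize (a u)).
Proof.
move=> [q tq]; exists q => u Du; have [t et tT] := tq u Du.
by apply: leq_trans tT; case: (eval_dsize et).
Qed.

Lemma poly_time_out p a b : poly_time p a b -> poly_bounded (fun u => dsize (b u)).
Proof.
move=> [q tq]; exists q => u Du; have [t et tT] := tq u Du.
by apply: leq_trans tT; case: (eval_dsize et).
Qed.

Lemma eq_poly_time p a a' b b' : (forall u, D u -> a u = a' u) -> (forall u, D u -> b u = b' u) ->
  poly_time p a b -> poly_time p a' b'.
Proof. by move=> ea eb [q tq]; exists q => u Du; rewrite -ea // -eb //; apply: tq. Qed.

Lemma poly_time_id a b : (forall u, D u -> b u = a u) ->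
  poly_bounded (fun u => dsize (a u)) -> poly_time PId a b.
Proof.
by move=> eb /poly_timeE; apply=> u Du; exists (dsize (a u)) => //; rewrite eb //; constructor.
Qed.

Lemma poly_time_nil a b : (forall u, D u -> b u = Nil) ->
  poly_bounded (fun u => dsize (a u)) -> poly_time PNil a b.
Proof.
by move=> eb /poly_timeE; apply=> u Du; exists (dsize (a u)) => //; rewrite eb //; constructor.
Qed.

Lemma poly_time_hd a b : (forall u, D u -> b u = hd (a u)) ->
  poly_bounded (fun u => dsize (a u)) -> poly_time PHd a b.
Proof.
by move=> eb /poly_timeE; apply=> u Du; exists (dsize (a u)) => //; rewrite eb //; constructor.
Qed.

Lemma poly_time_tl a b : (forall u, D u -> b u = tl (a u)) ->
  poly_bounded (fun u => dsize (a u)) -> poly_time PTl a b.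
Proof.
by move=> eb /poly_timeE; apply=> u Du; exists (dsize (a u)) => //; rewrite eb //; constructor.
Qed.

Lemma poly_time_pair p q a b c : poly_time p a b -> poly_time q a c ->
  poly_time (PPair p q) a (fun u => Cons (b u) (c u)).
Proof.
move=> tp tq; have ba := poly_time_in tp; move: tp tq => [P tp] [Q tq].
have bPQ : poly_bounded (fun u => dsize (a u) + P.[N u]%R + Q.[N u]%R).
  by apply: poly_bounded_add; [apply: poly_bounded_add => // | ]; [exists P | exists Q].
apply: poly_timeE bPQ _ => u Du.
have [t et tT] := tp u Du; have [s es sT] := tq u Du.
by exists (dsize (a u) + t + s); [constructor | rewrite !leq_add].
Qed.

Lemma poly_time_seq p q a b c : poly_time p a b -> poly_time q b c ->
  poly_time (PSeq p q) a c.
Proof.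
move=> [P tp] [Q tq]; exists (P + Q)%R => u Du.
have [t et tT] := tp u Du; have [s es sT] := tq u Du.
by exists (t + s); [apply: ESeq et es | rewrite hornerD; apply: leq_add].
Qed.

End PolyTime.

Lemma poly_bounded_reindex U U' (D : U -> Prop) (D' : U' -> Prop) N T (g : U' -> U) :
  (forall u, D' u -> D (g u)) -> poly_bounded D N T ->
  poly_bounded D' (fun u => N (g u)) (fun u => T (g u)).
Proof. by move=> gD [q bq]; exists q => u /gD; apply: bq. Qed.

Lemma poly_time_transfer U U' (D : U -> Prop) (D' : U' -> Prop) N N' p a a' b b' :
  (forall u', D' u' -> exists u, [/\ D u, N u = N' u', a u = a' u' & b u = b' u']) ->
  poly_time D N p a b -> poly_time D' N' p a' b'.
Proof. by move=> tr [q tq]; exists q => u' /tr[u [Du <- <- <-]]; apply: tq. Qed.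

(** * Conditionals, loop-free programs and loops *)

Definition is_cons (d : data) : bool := if d is Cons _ _ then true else false.

Lemma poly_time_if U D (N : U -> nat) c p q a b d :
  poly_time D N c a d ->
  poly_time (fun u => D u /\ is_cons (d u)) N p a b ->
  poly_time (fun u => D u /\ ~~ is_cons (d u)) N q a b ->
  poly_time D N (PIf c p q) a b.
Proof.
move=> tc [Qp tp] [Qq tq]; have ba := poly_time_in tc; move: tc => [Qc tc].
have bQ : poly_bounded D N (fun u => dsize (a u) + Qc.[N u]%R + (Qp.[N u]%R + Qq.[N u]%R)).
  by do !apply: poly_bounded_add => //; [exists Qc | exists Qp | exists Qq].
apply: poly_timeE bQ _ => u Du; have [t et tT] := tc u Du.
case ed : (d u) et => [|x y] et.
  have [|s es sT] := tq u; first by rewrite ed.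
  exists (dsize (a u) + t + s); first exact: EIfFalse et es.
  by rewrite !leq_add // (leq_trans sT) // leq_addl.
have [|s es sT] := tp u; first by rewrite ed.
exists (dsize (a u) + t + s); first exact: EIfTrue et es.
by rewrite !leq_add // (leq_trans sT) // leq_addr.
Qed.

Fixpoint loop_free (p : prog) : bool :=
  match p with
  | PPair p q | PSeq p q => loop_free p && loop_free q
  | PIf c p q => [&& loop_free c, loop_free p & loop_free q]
  | PWhile _ _ => false
  | _ => true
  end.

(* Meaningless on loops. *)
Fixpoint result (p : prog) (x : data) : data :=
  match p with
  | PId | PWhile _ _ => x
  | PNil => Nil
  | PHd => hd x
  | PTl => tl x
  | PPair p q => Cons (result p x) (result q x)
  | PSeq p q => result q (result p x)
  | PIf c p q => if is_cons (result c x) then result p x else result q x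
  end.

(** Since [result] computes the output, correctness goals for loop-free programs mostly reduce to
    computation. The induction generalizes [D], [a] and [b] because [PIf] shrinks the domain and
    [PSeq] changes the input. *)
Lemma poly_time_loop_free U D (N : U -> nat) p a b : loop_free p ->
  (forall u, D u -> b u = result p (a u)) -> poly_bounded D N (fun u => dsize (a u)) ->
  poly_time D N p a b.
Proof.
elim: p D a b => [||||p IHp q IHq|p IHp q IHq|c IHc p IHp q IHq|//] D a b /=.
- by move=> _; apply: poly_time_id.
- by move=> _; apply: poly_time_nil.
- by move=> _; apply: poly_time_hd.
- by move=> _; apply: poly_time_tl.
- move=> /andP[lp lq] eb ba.
  have := poly_time_pair (IHp D a _ lp (fun _ _ => erefl) ba) (IHq D a _ lq (fun _ _ => erefl) ba).
  by apply: eq_poly_time => // u Du; rewrite eb.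
- move=> /andP[lp lq] eb ba; have tp := IHp D a _ lp (fun _ _ => erefl) ba.
  exact: poly_time_seq tp (IHq D _ b lq eb (poly_time_out tp)).
- move=> /and3P[lc lp lq] eb ba.
  apply: (poly_time_if (IHc D a _ lc (fun _ _ => erefl) ba)).
    apply: IHp => // [u [Du cu]|]; first by rewrite eb // cu.
    by apply: (poly_bounded_reindex (g := id) _ ba) => u [].
  apply: IHq => // [u [Du cu]|]; first by rewrite eb // (negbTE cu).
  by apply: (poly_bounded_reindex (g := id) _ ba) => u [].
Qed.

(** [st u k] is the state after [k] rounds. Polynomially many rounds, each bounded by the same
    polynomial in [N u], stay polynomial in total. *)
Lemma poly_time_while U D (N : U -> nat) p (st : U -> nat -> data) (m : U -> nat) :
  poly_time (fun uk => D uk.1 /\ uk.2 < m uk.1) (fun uk => N uk.1) p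
    (fun uk => st uk.1 uk.2) (fun uk => st uk.1 uk.2.+1) ->
  (forall u k, D u -> k < m u -> hd (st u k) <> Nil) ->
  (forall u, D u -> hd (st u (m u)) = Nil) ->
  poly_bounded D N m -> poly_bounded D N (fun u => dsize (st u (m u))) ->
  poly_time D N (PWhile PHd p) (fun u => st u 0) (fun u => st u (m u)).
Proof.
move=> [Q tp] go stop bm bst.
(* A round pays for its state twice, in the loop and in the test [PHd], and once for the body, whose
   time dominates the size of the state: at most three times [Q]. The last test pays twice for the
   final state. *)
have bT : poly_bounded D N (fun u => m u * (3 * Q.[N u]%R) + 2 * dsize (st u (m u))).
  apply: poly_bounded_add; last by apply: poly_bounded_mul => //; apply: poly_bounded_const.
  by apply: poly_bounded_mul => //; apply: poly_bounded_mul; [apply: poly_bounded_const | exists Q].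
apply: poly_timeE bT _ => u Du.
suff run j : j <= m u -> exists2 t, eval (PWhile PHd p) (st u (m u - j)) (st u (m u)) t &
    t <= j * (3 * Q.[N u]%R) + 2 * dsize (st u (m u)).
  by have := run (m u) (leqnn _); rewrite subnn.
elim: j => [|j IH] jm.
  rewrite subn0; exists (dsize (st u (m u)) + dsize (st u (m u))); last by rewrite mul2n addnn.
  by apply: EWhileFalse; rewrite -(stop u Du); constructor.
have [t et tT] := IH (ltnW jm).
have km : m u - j.+1 < m u by rewrite -subn_gt0 in jm *; lia.
have [s es sT] := tp (u, m u - j.+1) (conj Du km); rewrite /= in es sT.
have [dx _] := eval_dsize es; have := go u _ Du km.
case ex : (hd _) => [//|x y] _; rewrite -subSn // subSS in es.
exists (dsize (st u (m u - j.+1)) + dsize (st u (m u - j.+1)) + s + t); last by lia.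
have eh : eval PHd (st u (m u - j.+1)) (Cons x y) (dsize (st u (m u - j.+1))).
  by rewrite -ex; constructor.
exact: EWhileTrue eh es et.
Qed.

(** * Lists *)

Lemma dsize_enc_list V (f : V -> data) s :
  dsize (enc_list f s) = (sumn [seq (dsize (f v)).+1 | v <- s]).+1.
Proof. by elim: s => //= v s ->; rewrite -addSnnS. Qed.

Lemma size_enc_list V (f : V -> data) s : size s <= dsize (enc_list f s).
Proof. by rewrite dsize_enc_list; elim: s => //= v s; lia. Qed.

Lemma enc_list_map V W (f : W -> data) (g : V -> W) s :
  enc_list f (map g s) = enc_list (fun v => f (g v)) s.
Proof. exact: foldr_map. Qed.

Lemma dsize_enc_list_le (V : eqType) (f : V -> data) s b :
  {in s, forall v, dsize (f v) <= b} -> dsize (enc_list f s) <= (size s * b.+1).+1.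
Proof.
rewrite dsize_enc_list ltnS; elim: s => //= v s IH le.
rewrite mulSn leq_add ?ltnS ?le ?mem_head // IH // => w ws.
by rewrite le // inE ws orbT.
Qed.

Lemma dsize_enc_list_in (V : eqType) (f : V -> data) s v :
  v \in s -> dsize (f v) <= dsize (enc_list f s).
Proof.
rewrite dsize_enc_list; elim: s => //= w s IH; rewrite inE => /predU1P[->|/IH]; lia.
Qed.

(** Returns [enc_bool true] on every input, and so also serves as the test that accepts
    everything. *)
Definition POne : prog := PPair PNil PNil.

Definition PElem : prog := PSeq PHd PHd.

(* Moves the elements [e] of the list [hd x] that pass the test [c] to the list
   [tl x], applying [p] to them. *)
Definition PFilterMap (c p : prog) : prog :=
  PSeq (PWhile PHd (PPair (PSeq PHd PTl)
         (PIf (PSeq PElem c) (PPair (PSeq PElem p) PTl) PTl))) PTl.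

Section FilterMap.
Variables (U : Type) (V : eqType) (W : Type) (D : U -> Prop) (N : U -> nat).
Variables (fV : V -> data) (fW : W -> data) (c p : prog) (P : pred V) (h : V -> W).
Variables (l : U -> seq V) (l0 : U -> seq W).
Hypothesis c_time : poly_time (fun uv => D uv.1 /\ uv.2 \in l uv.1) (fun uv => N uv.1) c
  (fun uv => fV uv.2) (fun uv => enc_bool (P uv.2)).
Hypothesis p_time : poly_time (fun uv => [/\ D uv.1, uv.2 \in l uv.1 & P uv.2])
  (fun uv => N uv.1) p (fun uv => fV uv.2) (fun uv => fW (h uv.2)).
Hypothesis l_bounded : poly_bounded D N (fun u => dsize (enc_list fV (l u))).
Hypothesis l0_bounded : poly_bounded D N (fun u => dsize (enc_list fW (l0 u))).

(** The accumulator after [k] elements. Elements are pushed at its head, hence the reversal, which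
    is harmless for families as they may be listed in any order. *)
Let out u k := rev (map h (filter P (take k (l u)))) ++ l0 u.
Let st u k := Cons (enc_list fV (drop k (l u))) (enc_list fW (out u k)).

(** The remaining input is a suffix of [l u]. The accumulator gains at most [size (l u)] elements,
    each polynomially bounded as an output of [p]. *)
Let st_bounded : poly_bounded (fun uk => D uk.1) (fun uk => N uk.1)
  (fun uk => dsize (st uk.1 uk.2)).
Proof.
have [Q bQ] := poly_time_out p_time.
have bT : poly_bounded D N (fun u => dsize (enc_list fV (l u)) +
    (dsize (enc_list fV (l u)) * (Q.[N u]%R).+1 + dsize (enc_list fW (l0 u))).+1).
  apply: poly_bounded_add => //; rewrite -[X in poly_bounded _ _ X]/(fun u => 1 + (_ + _)).
  apply: poly_bounded_add; first exact: poly_bounded_const.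
  apply: poly_bounded_add => //; apply: poly_bounded_mul => //.
  by exists (1 + Q)%R => u _; rewrite hornerD hornerC.
have [R bR] := bT; exists R => -[u k] /= Du; apply: leq_trans (bR u Du).
rewrite -addnS leq_add //.
  by rewrite -{2}(cat_take_drop k (l u)) !dsize_enc_list map_cat sumn_cat ltnS leq_addl.
rewrite ltnS /out !dsize_enc_list map_cat sumn_cat addnS ltnS leq_add2r.
rewrite map_rev sumn_rev -map_comp.
have : size (filter P (take k (l u))) <= (sumn [seq (dsize (fV v)).+1 | v <- l u]).+1.
  rewrite -dsize_enc_list (leq_trans _ (size_enc_list fV (l u))) //.
  by rewrite size_filter (leq_trans (count_size _ _)) // size_take_min geq_minr.
move/(leq_mul (leqnn (Q.[N u]%R).+1)); rewrite mulnC [X in _ <= X]mulnC; apply: leq_trans.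
have : {subset filter P (take k (l u)) <= filter P (l u)}.
  by move=> v; rewrite !mem_filter => /andP[-> /mem_take].
elim: (filter P (take k (l u))) => //= v s IH sub.
rewrite mulSn leq_add ?IH // => [|w ws]; last by rewrite sub // inE ws orbT.
have := sub v (mem_head _ _); rewrite mem_filter => /andP[Pv vl].
exact: bQ (u, v) (And3 Du vl Pv).
Qed.

Lemma poly_time_filter_map :
  poly_time D N (PFilterMap c p)
    (fun u => Cons (enc_list fV (l u)) (enc_list fW (l0 u)))
    (fun u => enc_list fW (rev (map h (filter P (l u))) ++ l0 u)).
Proof.
have st0 u : st u 0 = Cons (enc_list fV (l u)) (enc_list fW (l0 u)).
  by rewrite /st /out take0 drop0.
have stm u : st u (size (l u)) = Cons Nil (enc_list fW (rev (map h (filter P (l u))) ++ l0 u)).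
  by rewrite /st /out take_size drop_size.
have bst : poly_bounded D N (fun u => dsize (st u (size (l u)))).
  exact: (poly_bounded_reindex (g := fun u => (u, size (l u))) _ st_bounded).
apply: (poly_time_seq (b := fun u => st u (size (l u)))); last first.
  by apply: poly_time_tl bst => u _; rewrite stm.
have : poly_time D N (PWhile PHd (PPair (PSeq PHd PTl)
         (PIf (PSeq PElem c) (PPair (PSeq PElem p) PTl) PTl)))
         (fun u => st u 0) (fun u => st u (size (l u))).
  apply: poly_time_while => //.
  (* Rounds are indexed by triples that carry the head [v] of the remaining list, so that the facts
     about [c] and [p], stated for members of [l u], transfer to them. *)
  - pose D' := fun uvk : U * V * nat => [/\ D uvk.1.1, uvk.2 < size (l uvk.1.1)
      & drop uvk.2 (l uvk.1.1) = uvk.1.2 :: drop uvk.2.+1 (l uvk.1.1)].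
    have bD' (E : U * V * nat -> Prop) : (forall i, E i -> D' i) ->
        poly_bounded E (fun i => N i.1.1) (fun i => dsize (st i.1.1 i.2)).
      move=> ED; apply: (poly_bounded_reindex (g := fun i => (i.1.1, i.2)) _ st_bounded).
        exact: (fun i Ei => let: And3 Du _ _ := ED i Ei in Du).
    have elem (E : U * V * nat -> Prop) : (forall i, E i -> D' i) ->
        poly_time E (fun i => N i.1.1) PElem (fun i => st i.1.1 i.2) (fun i => fV i.1.2).
      move=> ED; have t1 := poly_time_hd (fun _ _ => erefl) (bD' E ED).
      apply: (poly_time_seq t1); apply: poly_time_hd (poly_time_out t1).
      by move=> i /ED[_ _ /= ->].
    have memD i : D' i -> i.1.2 \in l i.1.1.
      by case=> _ _ e; apply: (@mem_drop i.2); rewrite e mem_head.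
    have outS i : D' i ->
        out i.1.1 i.2.+1 = if P i.1.2 then h i.1.2 :: out i.1.1 i.2 else out i.1.1 i.2.
      case: i => -[u v] k [/= _ kl e]; rewrite /out.
      have -> : take k.+1 (l u) = rcons (take k (l u)) v.
        by rewrite (take_nth v) //; congr rcons; rewrite -[k]addn0 -nth_drop e.
      by rewrite filter_rcons; case: (P v); rewrite ?map_rcons ?rev_rcons.
    have : poly_time D' (fun i => N i.1.1) (PPair (PSeq PHd PTl)
         (PIf (PSeq PElem c) (PPair (PSeq PElem p) PTl) PTl))
         (fun i => st i.1.1 i.2) (fun i => st i.1.1 i.2.+1).
      apply: poly_time_pair.
        have t1 := poly_time_hd (fun _ _ => erefl) (bD' D' (fun _ => id)).
        apply: (poly_time_seq t1); apply: poly_time_tl (poly_time_out t1).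
        by move=> i [_ _ /= ->].
      apply: (poly_time_if (d := fun i => enc_bool (P i.1.2))).
      + apply: poly_time_seq (elem _ _) _ => //.
        apply: poly_time_transfer c_time => -[[u v] k] Di.
        by exists (u, v); split=> //; split; [case: Di | apply: (memD _ Di)].
      + set E := fun i => _; have ED i : E i -> D' i by case.
        have := poly_time_pair (poly_time_seq (elem E ED) _)
          (poly_time_tl (fun _ _ => erefl) (bD' E ED)).
        move=> /(_ p (fun i => fW (h i.1.2))) t1.
        apply: eq_poly_time (t1 _) => //= [i [Di]|]; first by rewrite outS //; case: (P _).
        apply: poly_time_transfer p_time => -[[u v] k] [Di] /= Pi.
        by exists (u, v); split=> //; split=> /=; [case: Di | apply: (memD _ Di) | case: (P v) Pi].
      + set E := fun i => _; have ED i : E i -> D' i by case.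
        by apply: poly_time_tl (bD' E ED) => i [Di]; rewrite outS //; case: (P _).
    apply: poly_time_transfer => -[u k] [/= Du kl].
    case e : (drop k (l u)) => [|v s]; first by move: kl; rewrite -subn_gt0 -size_drop e.
    exists (u, v, k); split=> //; split=> //=.
    by rewrite e -addn1 addnC -drop_drop e /= drop0.
  - move=> u k Du kl; rewrite /st /=; case e : (drop k (l u)) => //.
    by move: kl; rewrite -subn_gt0 -size_drop e.
  - by move=> u Du; rewrite stm.
  - apply: poly_bounded_le l_bounded => u _; exact: size_enc_list.
by apply: eq_poly_time => // u _; rewrite st0.
Qed.
End FilterMap.

(** * Programs on families of bit vectors *)

Definition enc_bits : seq bool -> data := enc_list enc_bool.

Definition enc_bits2 (i : seq bool * seq bool) : data := Cons (enc_bits i.1) (enc_bits i.2).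

Lemma hd_enc_bits s : hd (enc_bits s) = enc_bool (head false s).
Proof. by case: s. Qed.

Lemma tl_enc_bits s : tl (enc_bits s) = enc_bits (behead s).
Proof. by case: s. Qed.

Lemma is_cons_enc_bool b : is_cons (enc_bool b) = b.
Proof. by case: b. Qed.

(** Programs on vectors therefore apply to numbers: [PMapBits POne] turns the code of [n] into the
    vector of the full set. *)
Lemma enc_natE k : enc_nat k = enc_bits (nseq k false).
Proof. by elim: k => //= k ->. Qed.

Lemma dsize_enc_nat k : dsize (enc_nat k) = k.*2.+1.
Proof. by elim: k => //= k ->. Qed.

Lemma dsize_enc_bits s : dsize (enc_bits s) <= (size s * 4).+1.
Proof. by apply: dsize_enc_list_le => -[]. Qed.

Definition PMap (c p : prog) : prog := PSeq (PPair PId PNil) (PFilterMap c p).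

Lemma poly_time_map U (V : eqType) W D (N : U -> nat) (fV : V -> data) (fW : W -> data)
    c p (P : pred V) (h : V -> W) (l : U -> seq V) :
  poly_time (fun uv => D uv.1 /\ uv.2 \in l uv.1) (fun uv => N uv.1) c
    (fun uv => fV uv.2) (fun uv => enc_bool (P uv.2)) ->
  poly_time (fun uv => [/\ D uv.1, uv.2 \in l uv.1 & P uv.2]) (fun uv => N uv.1) p
    (fun uv => fV uv.2) (fun uv => fW (h uv.2)) ->
  poly_bounded D N (fun u => dsize (enc_list fV (l u))) ->
  poly_time D N (PMap c p) (fun u => enc_list fV (l u))
    (fun u => enc_list fW (rev (map h (filter P (l u))))).
Proof.
move=> tc tp bl; have b0 : poly_bounded D N (fun u => dsize (enc_list fW [::])).
  exact: poly_bounded_const.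
apply: poly_time_seq (poly_time_loop_free _ (fun _ _ => erefl) bl) _ => //=.
by have := poly_time_filter_map tc tp bl b0; apply: eq_poly_time => // u _; rewrite cats0.
Qed.

Lemma poly_bounded_elem U (V : eqType) (D : U -> Prop) (N : U -> nat) (fV : V -> data)
    (l : U -> seq V) (E : U * V -> Prop) :
  poly_bounded D N (fun u => dsize (enc_list fV (l u))) ->
  (forall uv, E uv -> D uv.1 /\ uv.2 \in l uv.1) ->
  poly_bounded E (fun uv => N uv.1) (fun uv => dsize (fV uv.2)).
Proof.
move=> [q bq] EP; exists q => uv /EP[Du vl].
by apply: leq_trans (bq _ Du); apply: dsize_enc_list_in.
Qed.

Lemma poly_time_map_all U (V : eqType) W D (N : U -> nat) (fV : V -> data) (fW : W -> data)
    p (h : V -> W) (l : U -> seq V) :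
  poly_time (fun uv => D uv.1 /\ uv.2 \in l uv.1) (fun uv => N uv.1) p
    (fun uv => fV uv.2) (fun uv => fW (h uv.2)) ->
  poly_bounded D N (fun u => dsize (enc_list fV (l u))) ->
  poly_time D N (PMap POne p) (fun u => enc_list fV (l u))
    (fun u => enc_list fW (rev (map h (l u)))).
Proof.
move=> tp bl; have := @poly_time_map U V W D N fV fW POne p xpredT h l _ _ bl.
move=> t; apply: eq_poly_time (t _ _) => // [u _|| ]; first by rewrite filter_predT.
  by apply: poly_time_loop_free => //; apply: poly_bounded_elem bl _.
by apply: poly_time_transfer tp => uv [Du vl _]; exists uv.
Qed.

(** The second pass only undoes the reversal caused by the first: inside a vector the order
    matters. *)
Definition PMapBits (p : prog) : prog := PSeq (PMap POne p) (PMap POne PId).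

Lemma poly_time_map_bits U D (N : U -> nat) p (g : bool -> bool) (s : U -> seq bool) :
  loop_free p -> (forall b, result p (enc_bool b) = enc_bool (g b)) ->
  poly_bounded D N (fun u => dsize (enc_bits (s u))) ->
  poly_time D N (PMapBits p) (fun u => enc_bits (s u)) (fun u => enc_bits (map g (s u))).
Proof.
move=> lp ep bs.
have t1 : poly_time D N (PMap POne p) (fun u => enc_bits (s u))
    (fun u => enc_bits (rev (map g (s u)))).
  apply: poly_time_map_all (bs); apply: poly_time_loop_free => //.
  exact: poly_bounded_elem bs _.
apply: (poly_time_seq t1); have bt := poly_time_out t1.
have := @poly_time_map_all _ _ _ D N enc_bool enc_bool PId id _ _ bt.
move=> t; apply: eq_poly_time (t _) => // [u _|]; first by rewrite map_id revK.
by apply: poly_time_loop_free => //; apply: poly_bounded_elem bt _.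
Qed.

Definition PNot : prog := PIf PId PNil POne.

(** The flag [co] is set when the required family consists of the complements of the sets read off,
    so that one program covers both MIS and MHS. *)
Definition PMaybeCompl (co : bool) : prog := if co then PMapBits PNot else PId.

Definition maybe_compl (co : bool) (s : seq bool) : seq bool := if co then map negb s else s.

Lemma poly_time_maybe_compl U D (N : U -> nat) co (s : U -> seq bool) :
  poly_bounded D N (fun u => dsize (enc_bits (s u))) ->
  poly_time D N (PMaybeCompl co) (fun u => enc_bits (s u))
    (fun u => enc_bits (maybe_compl co (s u))).
Proof.
case: co => bs; last exact: poly_time_loop_free.
by apply: poly_time_map_bits => // -[].
Qed.

(** * Programs translating instances and reading back answers *)

Definition PPremises : prog :=
  PPair (PPair PNil (PPair PNil PHd))
    (PSeq PTl (PMap POne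
      (PPair (PPair PNil (PPair POne PId)) (PPair POne (PPair PNil (PMapBits PNil)))))).

(** The two leading bits stand for the implied point and the apex: this is the vector form of
    [point_imp (ext true E)]. *)
Definition premise (E : seq bool) : seq bool * seq bool :=
  ([:: false, true & E], [:: true, false & map xpred0 E]).

Notation code_bits n l := (Cons (enc_nat n) (enc_list enc_bits l)).

Lemma dsize_code_list V (f : V -> data) n (l : seq V) :
  dsize (enc_nat n) <= dsize (Cons (enc_nat n) (enc_list f l)) /\
  dsize (enc_list f l) <= dsize (Cons (enc_nat n) (enc_list f l)).
Proof. by rewrite /=; lia. Qed.

Lemma poly_time_premises :
  poly_time (fun _ : nat * seq (seq bool) => True) (fun u => dsize (code_bits u.1 u.2))
    PPremises (fun u => code_bits u.1 u.2)
    (fun u => Cons (enc_nat u.1.+2) (enc_list enc_bits2 (rev (map premise u.2)))).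
Proof.
set D := fun _ => True; set N := fun u => _.
have bx : poly_bounded D N (fun u => dsize (code_bits u.1 u.2)) by apply: poly_bounded_size.
have bl : poly_bounded D N (fun u => dsize (enc_list enc_bits u.2)).
  by apply: poly_bounded_le bx => u _; case: (dsize_code_list enc_bits u.1 u.2).
apply: (poly_time_pair (b := fun u => enc_nat u.1.+2)); first exact: poly_time_loop_free.
apply: (poly_time_seq (b := fun u => enc_list enc_bits u.2)); first exact: poly_time_loop_free.
apply: poly_time_map_all (bl).
have be := poly_bounded_elem (E := fun uv => D uv.1 /\ uv.2 \in uv.1.2) bl (fun _ => id).
apply: (poly_time_pair (b := fun uv => enc_bits (premise uv.2).1)
                       (c := fun uv => enc_bits (premise uv.2).2)).
  exact: poly_time_loop_free.
apply: (poly_time_pair (b := fun uv => enc_bool true)); first exact: poly_time_loop_free.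
apply: (poly_time_pair (b := fun uv => Nil)); first exact: poly_time_loop_free.
exact: poly_time_map_bits.
Qed.

Definition PIrrPost (co : bool) : prog :=
  PMap (PIf PHd PNil (PSeq PTl PHd)) (PSeq (PSeq PTl PTl) (PMaybeCompl co)).

(** The set avoids the implied point and contains the apex; by [maxset_apexed_true] such irreducible
    sets encode the maximal independent sets. *)
Definition irr_kept (s : seq bool) : bool := ~~ head false s && head false (behead s).

Lemma poly_time_irr_post co :
  poly_time (fun _ : seq (seq bool) => True) (fun l => dsize (enc_list enc_bits l))
    (PIrrPost co) (enc_list enc_bits)
    (fun l => enc_list enc_bits
       (rev [seq maybe_compl co (behead (behead s)) | s <- l & irr_kept s])).
Proof.
have bl := poly_bounded_size (fun _ : seq (seq bool) => True)
  (fun l => dsize (enc_list enc_bits l)).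
apply: (poly_time_map (l := id)
  (h := fun s => maybe_compl co (behead (behead s))) (P := irr_kept)) => //=.
  apply: poly_time_loop_free => // [[l s] _|] /=; last exact: poly_bounded_elem bl _.
  by rewrite tl_enc_bits !hd_enc_bits is_cons_enc_bool /irr_kept; case: (head _ s).
apply: (poly_time_seq (b := fun uv => enc_bits (behead (behead uv.2)))).
  apply: poly_time_loop_free => // [[l s] _|] /=; first by rewrite !tl_enc_bits.
  by apply: (poly_bounded_elem (l := id) bl) => uv [].
apply: poly_time_maybe_compl; apply: (@poly_bounded_le _ _ _ _ (fun uv => dsize (enc_bits uv.2))).
  by case=> l [|b [|c s]] //= _; lia.
by apply: (poly_bounded_elem (l := id) bl) => uv [].
Qed.

Definition PPremisePost (co : bool) : prog :=
  PMap (PIf (PSeq PHd (PSeq PTl (PSeq PTl PHd))) PNil POne)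
    (PSeq (PSeq PHd (PSeq PTl (PSeq PTl PTl))) (PMaybeCompl co)).

(** The third bit of a premise is that of [u], set only in the spurious premise made of [w] and
    [u]. *)
Definition premise_kept (i : seq bool * seq bool) : bool := ~~ head false (behead (behead i.1)).

Lemma poly_time_premise_post co :
  poly_time (fun _ : seq (seq bool * seq bool) => True) (fun l => dsize (enc_list enc_bits2 l))
    (PPremisePost co) (enc_list enc_bits2)
    (fun l => enc_list enc_bits
       (rev [seq maybe_compl co (behead (behead (behead i.1))) | i <- l & premise_kept i])).
Proof.
have bl := poly_bounded_size (fun _ : seq (seq bool * seq bool) => True)
  (fun l => dsize (enc_list enc_bits2 l)).
apply: (poly_time_map (l := id)
  (h := fun i => maybe_compl co (behead (behead (behead i.1)))) (P := premise_kept)) => //=.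
  apply: poly_time_loop_free => // [[l i] _|] /=; last exact: poly_bounded_elem bl _.
  by rewrite !tl_enc_bits hd_enc_bits is_cons_enc_bool /premise_kept; case: (head _ _).
apply: (poly_time_seq (b := fun uv => enc_bits (behead (behead (behead uv.2.1))))).
  apply: poly_time_loop_free => // [[l i] _|] /=; first by rewrite !tl_enc_bits.
  by apply: (poly_bounded_elem (l := id) bl) => uv [].
apply: poly_time_maybe_compl; apply: (@poly_bounded_le _ _ _ _ (fun uv => dsize (enc_bits2 uv.2))).
  by case=> l [[|b [|c [|d s]]] s'] //= _; lia.
by apply: (poly_bounded_elem (l := id) bl) => uv [].
Qed.

(** The vectors of the complements of single points, in the order in which [PCoatoms] produces them;
    the reversal is that of [PMap]. *)
Fixpoint coatoms (k : nat) : seq (seq bool) :=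
  if k is k'.+1 then (false :: nseq k' true) :: rev (map (cons true) (coatoms k')) else [::].

Lemma size_coatoms k : size (coatoms k) = k.
Proof. by elim: k => //= k IH; rewrite size_rev size_map IH. Qed.

Lemma coatoms_size k s : s \in coatoms k -> size s = k.
Proof.
elim: k s => //= k IH s; rewrite inE mem_rev => /predU1P[->|/mapP[t /IH <- ->] //].
by rewrite /= size_nseq.
Qed.

Definition PCoatoms : prog :=
  PSeq (PPair PId (PPair PNil PNil))
    (PSeq (PWhile PHd
       (PPair (PSeq PHd PTl)
         (PPair (PPair (PPair PNil (PSeq PTl PTl))
                       (PSeq (PSeq PTl PHd) (PMap POne (PPair POne PId))))
                (PPair POne (PSeq PTl PTl)))))
       (PSeq PTl PHd)).

Lemma poly_time_map_cons U D (N : U -> nat) (l : U -> seq (seq bool)) :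
  poly_bounded D N (fun u => dsize (enc_list enc_bits (l u))) ->
  poly_time D N (PMap POne (PPair POne PId)) (fun u => enc_list enc_bits (l u))
    (fun u => enc_list enc_bits (rev (map (cons true) (l u)))).
Proof.
move=> bl; apply: poly_time_map_all (bl); apply: poly_time_loop_free => //.
exact: poly_bounded_elem bl _.
Qed.

(** The loop state holds a countdown, the coatoms of length [k] and a vector of [k] true bits. A
    round prefixes a true bit to the old coatoms and adds the one that omits the new point. *)
Lemma poly_time_coatoms U D (N m : U -> nat) : poly_bounded D N m ->
  poly_time D N PCoatoms (fun u => enc_nat (m u)) (fun u => enc_list enc_bits (coatoms (m u))).
Proof.
move=> bm.
pose st u k := Cons (enc_nat (m u - k))
  (Cons (enc_list enc_bits (coatoms k)) (enc_bits (nseq k true))).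
have bst (E : U * nat -> Prop) : (forall uk, E uk -> D uk.1 /\ uk.2 <= m uk.1) ->
    poly_bounded E (fun uk => N uk.1) (fun uk => dsize (st uk.1 uk.2)).
  move=> ED.
  (* Countdown, list and vector have sizes at most [2 * (m u - k) + 1], [k * (4 * k + 2) + 1] and
     [4 * k + 1], and two more nodes join them. *)
  have bT : poly_bounded D N (fun u => 5 + m u * (m u * 4 + 8)).
    apply: poly_bounded_add; first exact: poly_bounded_const.
    apply: poly_bounded_mul => //; apply: poly_bounded_add; last exact: poly_bounded_const.
    by apply: poly_bounded_mul => //; apply: poly_bounded_const.
  have [q bq] := bT; exists q => -[u k] /ED[/= Du km]; apply: leq_trans (bq u Du).
  have := dsize_enc_bits (nseq k true); rewrite size_nseq dsize_enc_nat => bk.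
  have : dsize (enc_list enc_bits (coatoms k)) <= (k * (k * 4).+2).+1.
    rewrite -{2}(size_coatoms k); apply: dsize_enc_list_le => s /coatoms_size sk.
    by have := dsize_enc_bits s; rewrite sk.
  by nia.
have bin : poly_bounded D N (fun u => dsize (enc_nat (m u))).
  apply: (@poly_bounded_le _ _ _ _ (fun u => 1 + 2 * m u)) => [u _|].
    by rewrite dsize_enc_nat; lia.
  by apply: poly_bounded_add; [|apply: poly_bounded_mul => //]; apply: poly_bounded_const.
have bend : poly_bounded D N (fun u => dsize (st u (m u))).
  by have [q bq] := bst (fun uk => D uk.1 /\ uk.2 <= m uk.1) (fun _ => id);
    exists q => u Du; apply: (bq (u, m u)).
apply: (poly_time_seq (b := fun u => st u 0)).
  by apply: poly_time_loop_free => // u _; rewrite /st subn0.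
apply: (poly_time_seq (b := fun u => st u (m u))); last exact: poly_time_loop_free.
apply: poly_time_while => //; first last.
- by move=> u _; rewrite /st subnn.
- by move=> u k _ km; rewrite /st /=; move: km; rewrite -subn_gt0; case: (_ - _).
set E := fun uk => _; have bE := bst E.
have {}bE : poly_bounded E (fun uk => N uk.1) (fun uk => dsize (st uk.1 uk.2)).
  by apply: bE => uk [Du /ltnW].
apply: (poly_time_pair (b := fun uk => enc_nat (m uk.1 - uk.2.+1))).
  by apply: poly_time_loop_free => // -[u k] [_ /= km]; rewrite -(subnSK km).
apply: (poly_time_pair (b := fun uk => enc_list enc_bits (coatoms uk.2.+1))
                       (c := fun uk => enc_bits (nseq uk.2.+1 true))); last first.
  exact: poly_time_loop_free.
apply: (poly_time_pair (b := fun uk => enc_bits (false :: nseq uk.2 true))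
   (c := fun uk => enc_list enc_bits (rev (map (cons true) (coatoms uk.2))))).
  exact: poly_time_loop_free.
apply: (poly_time_seq (b := fun uk => enc_list enc_bits (coatoms uk.2))).
  exact: poly_time_loop_free.
apply: poly_time_map_cons; apply: poly_bounded_le bE => uk _ /=; lia.
Qed.

Definition PIrreducibles : prog :=
  PPair (PPair PNil (PPair PNil (PPair PNil PHd)))
    (PSeq (PPair PTl
       (PPair (PPair PNil (PPair PNil (PPair POne (PSeq PHd (PMapBits POne)))))
              (PSeq (PPair PNil (PPair PNil PHd)) (PSeq PCoatoms (PMap POne (PPair POne PId))))))
       (PFilterMap POne (PPair PNil (PPair POne (PPair PNil (PMaybeCompl true)))))).

(** The leading bits are those of the implied point, [w] and [u]. The vectors starting with false
    come from the maximal members of [framed], the complements of the edges [u |: E] and [{w}]; each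
    other vector omits one point different from the implied one. *)
Definition irreducibles (n : nat) (l : seq (seq bool)) : seq (seq bool) :=
  rev [seq [:: false, true, false & map negb E] | E <- l] ++
  [:: false, false, true & nseq n true] :: rev (map (cons true) (coatoms n.+2)).

Lemma poly_time_irreducibles :
  poly_time (fun _ : nat * seq (seq bool) => True) (fun u => dsize (code_bits u.1 u.2))
    PIrreducibles (fun u => code_bits u.1 u.2)
    (fun u => code_bits u.1.+3 (irreducibles u.1 u.2)).
Proof.
set D := fun _ => True; set N := fun u => _.
have bx : poly_bounded D N (fun u => dsize (code_bits u.1 u.2)) by apply: poly_bounded_size.
have bl : poly_bounded D N (fun u => dsize (enc_list enc_bits u.2)).
  by apply: poly_bounded_le bx => u _; case: (dsize_code_list enc_bits u.1 u.2).
have bn : poly_bounded D N (fun u => dsize (enc_nat u.1)).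
  by apply: poly_bounded_le bx => u _; case: (dsize_code_list enc_bits u.1 u.2).
have bn2 : poly_bounded D N (fun u => u.1.+2).
  apply: (@poly_bounded_le _ _ _ _ (fun u => 1 + dsize (enc_nat u.1))) => [u _|].
    by rewrite dsize_enc_nat; lia.
  by apply: poly_bounded_add => //; apply: poly_bounded_const.
apply: (poly_time_pair (b := fun u => enc_nat u.1.+3)); first exact: poly_time_loop_free.
(* The vectors that depend only on [n] form the initial accumulator of the loop over the edges,
   which spares a concatenation. *)
pose l0 n := [:: false, false, true & nseq n true] :: rev (map (cons true) (coatoms n.+2)).
have t0 : poly_time D N (PPair (PPair PNil (PPair PNil (PPair POne (PSeq PHd (PMapBits POne)))))
      (PSeq (PPair PNil (PPair PNil PHd)) (PSeq PCoatoms (PMap POne (PPair POne PId)))))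
    (fun u => code_bits u.1 u.2) (fun u => enc_list enc_bits (l0 u.1)).
  apply: (poly_time_pair (b := fun u => enc_bits [:: false, false, true & nseq u.1 true])
     (c := fun u => enc_list enc_bits (rev (map (cons true) (coatoms u.1.+2))))).
    apply: (poly_time_pair (b := fun=> Nil)); first exact: poly_time_loop_free.
    apply: (poly_time_pair (b := fun=> Nil)); first exact: poly_time_loop_free.
    apply: (poly_time_pair (b := fun=> enc_bool true)); first exact: poly_time_loop_free.
    apply: (poly_time_seq (b := fun u => enc_bits (nseq u.1 false))).
      by apply: poly_time_loop_free => // u _; rewrite -enc_natE.
    have := @poly_time_map_bits _ D N POne xpredT (fun u => nseq u.1 false).
    move=> t; apply: eq_poly_time (t _ _ _) => // [u _|]; first by rewrite map_nseq.
    by apply: poly_bounded_le bn => u _; rewrite -enc_natE.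
  apply: (poly_time_seq (b := fun u => enc_nat u.1.+2)); first exact: poly_time_loop_free.
  have tc := poly_time_coatoms bn2.
  by apply: (poly_time_seq tc); apply: poly_time_map_cons (poly_time_out tc).
apply: (poly_time_seq (b := fun u => Cons (enc_list enc_bits u.2) (enc_list enc_bits (l0 u.1)))).
  by apply: poly_time_pair t0; apply: poly_time_loop_free.
have := @poly_time_filter_map _ _ _ D N enc_bits enc_bits POne
  (PPair PNil (PPair POne (PPair PNil (PMaybeCompl true)))) xpredT
  (fun E => [:: false, true, false & map negb E]) snd (fun u => l0 u.1) _ _ bl (poly_time_out t0).
move=> t; apply: eq_poly_time (t _ _) => // [u _||]; first by rewrite filter_predT.
  by apply: poly_time_loop_free => //; apply: poly_bounded_elem bl _.
have be := poly_bounded_elem (E := fun uv => [/\ D uv.1, uv.2 \in uv.1.2 & true]) bl.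
have {}be := be (fun uv E => let: And3 a b _ := E in conj a b).
apply: (poly_time_pair (b := fun=> Nil)); first exact: poly_time_loop_free.
apply: (poly_time_pair (b := fun=> enc_bool true)); first exact: poly_time_loop_free.
apply: (poly_time_pair (b := fun=> Nil)); first exact: poly_time_loop_free.
exact: (poly_time_maybe_compl true be).
Qed.

(** * Sets as bit vectors *)

Definition bits n (A : {set 'I_n}) : seq bool := [seq i \in A | i <- enum 'I_n].

Lemma enc_setE n (A : {set 'I_n}) : enc_set A = enc_bits (bits A).
Proof. by rewrite /enc_bits /bits enc_list_map. Qed.

Lemma enc_impE n (i : implication 'I_n) : enc_imp i = enc_bits2 (bits i.1, bits i.2).
Proof. by rewrite /enc_imp !enc_setE. Qed.

Lemma enc_list_setE n (s : seq {set 'I_n}) :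
  enc_list (@enc_set n) s = enc_list enc_bits (map (@bits n) s).
Proof. by rewrite enc_list_map; elim: s => //= A s ->; rewrite enc_setE. Qed.

Lemma enc_list_impE n (s : seq (implication 'I_n)) :
  enc_list (@enc_imp n) s = enc_list enc_bits2 [seq (bits i.1, bits i.2) | i <- s].
Proof. by rewrite enc_list_map; elim: s => //= i s ->; rewrite enc_impE. Qed.

Lemma size_bits n (A : {set 'I_n}) : size (bits A) = n.
Proof. by rewrite size_map size_enum_ord. Qed.

Lemma bits_ext n b (A : {set 'I_n}) : bits (ext b A) = b :: bits A.
Proof.
rewrite /bits enum_ordSl /= in_ext0 -map_comp; congr cons.
by apply: eq_map => i /=; rewrite in_ext_lift.
Qed.

Lemma head_bits n (C : {set 'I_n.+1}) : head false (bits C) = (ord0 \in C).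
Proof. by case: (extP C) => b A; rewrite bits_ext in_ext0. Qed.

Lemma behead_bits n (C : {set 'I_n.+1}) : behead (bits C) = bits (rest C).
Proof. by case: (extP C) => b A; rewrite bits_ext rest_ext. Qed.

Lemma bits_setT n : bits [set: 'I_n] = nseq n true.
Proof. by elim: n => [|n IH]; [rewrite /bits enum_ord0 | rewrite -ext_setT bits_ext IH]. Qed.

Lemma bits_setC n (A : {set 'I_n}) : bits (~: A) = map negb (bits A).
Proof. by rewrite /bits -map_comp; apply: eq_map => i; rewrite /= inE. Qed.

Lemma bits_set0 n (A : {set 'I_n}) : bits (set0 : {set 'I_n}) = map xpred0 (bits A).
Proof. by rewrite /bits -map_comp; apply: eq_map => i; rewrite /= inE. Qed.

Definition flip (T : finType) (co : bool) (A : {set T}) : {set T} := if co then ~: A else A.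

Lemma flipK T co : involutive (@flip T co).
Proof. by case: co => A //=; rewrite /flip setCK. Qed.

Lemma bits_flip n co (A : {set 'I_n}) : bits (flip co A) = maybe_compl co (bits A).
Proof. by case: co => //=; rewrite bits_setC. Qed.

Fixpoint coatom_sets (n : nat) : seq {set 'I_n} :=
  if n is n'.+1 then ext false setT :: rev (map (@ext n' true) (coatom_sets n')) else [::].

Lemma bits_coatom_sets n : map (@bits n) (coatom_sets n) = coatoms n.
Proof.
elim: n => //= n IH; rewrite bits_ext bits_setT map_rev -map_comp -IH -map_comp.
by congr (_ :: rev _); apply: eq_map => A /=; rewrite bits_ext.
Qed.

Lemma mem_coatom_sets n (A : {set 'I_n}) :
  reflect (exists v, A = [set~ v]) (A \in coatom_sets n).
Proof.
elim: n A => [|n IH] A; first by constructor=> -[[]].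
rewrite /= inE mem_rev; apply: (iffP predU1P) => [[->|/mapP[B /IH[v ->] ->]]|[v ->]].
- by exists ord0; rewrite ext_setC1_ord0.
- by exists (lift ord0 v); rewrite ext_setC1_lift.
- case: (unliftP ord0 v) => [j|] ->; [right | by left; rewrite ext_setC1_ord0].
  by rewrite -ext_setC1_lift map_f //; apply/IH; exists j.
Qed.

Lemma uniq_coatom_sets n : uniq (coatom_sets n).
Proof.
elim: n => //= n IH; rewrite rev_uniq (map_inj_uniq (@ext_injr n true)) IH andbT mem_rev.
by apply/mapP=> -[A _ /ext_inj[]].
Qed.

Lemma size_coatom_sets n : size (coatom_sets n) = n.
Proof. by rewrite -(size_map (@bits n)) bits_coatom_sets size_coatoms. Qed.

(** [g] and [g'] are inverse bijections between the kept members of [F] and [G]: injectivity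
    excludes repetitions, surjectivity makes the list complete. *)
Lemma perm_filter_map (T U : finType) (F : {set T}) (G : {set U}) (keep : pred T)
    (g : T -> U) (g' : U -> T) s :
  perm_eq s (enum F) ->
  (forall x, x \in F -> keep x -> g x \in G /\ g' (g x) = x) ->
  (forall y, y \in G -> [/\ g' y \in F, keep (g' y) & g (g' y) = y]) ->
  perm_eq (rev (map g (filter keep s))) (enum G).
Proof.
move=> ps gP g'P; have memF x : (x \in s) = (x \in F) by rewrite (perm_mem ps) mem_enum.
apply: uniq_perm; [rewrite rev_uniq | exact: enum_uniq | move=> y].
  rewrite map_inj_in_uniq ?filter_uniq ?(perm_uniq ps) ?enum_uniq // => x z.
  rewrite !mem_filter !memF => /andP[kx xF] /andP[kz zF] gxz.
  by rewrite -(gP x xF kx).2 gxz (gP z zF kz).2.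
rewrite mem_rev mem_enum; apply/mapP/idP => [[x]|/g'P[yF ky gy]].
  by rewrite mem_filter memF => /andP[kx xF] ->; case: (gP x xF kx).
by exists (g' y) => //; rewrite mem_filter memF ky.
Qed.

(** * Reductions *)

(** [B] runs [f], [A] and [g] in sequence. The bound [qo] keeps the answer of [A] polynomial in the
    input and output of [B], so that reading it back is polynomial overhead. *)
Lemma at_least_as_hard_by (Q P : problem) (f g : prog) (qf qg qo : {poly nat}) :
  (forall (I : instance P) x, valid I -> code I x ->
     exists (J : instance Q) x' t, [/\ valid J, code J x', eval f x x' t, t <= qf.[dsize x]%R &
       forall y', answer J y' -> exists y s, [/\ eval g y' y s, s <= qg.[dsize y']%R,
         answer I y & dsize y' <= qo.[(dsize x + dsize y)%N]%R]]) ->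
  at_least_as_hard Q P.
Proof.
move=> red; pose q := (qf + (qo + (qg \Po qo)))%R.
have qE n : q.[n]%R = qf.[n]%R + (qo.[n]%R + qg.[qo.[n]]%R) by rewrite /q !hornerD horner_comp.
exists f, q; split.
  move=> I x vI cx; have [J [x' [t [vJ cx' ef tq _]]]] := red I x vI cx.
  by exists J, x', t; split=> //; rewrite qE (leq_trans tq) ?leq_addr.
move=> A sA; exists (PSeq f (PSeq A g)).
split=> I x vI cx; have [J [x' [t [vJ cx' ef tq ans]]]] := red I x vI cx;
  have [y' [u [eA /ans[y [s [eg sq ay yq]]]]]] := sA J x' vJ cx'.
  by exists y, (t + (u + s)); split=> //; apply: ESeq ef (ESeq eA eg).
exists x', y', y, t, u, (t + (u + s)); split=> //; first exact: ESeq ef (ESeq eA eg).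
  by rewrite qE (leq_trans yq) // addnCA leq_addr.
rewrite qE addnCA leq_add2l leq_add //.
  by rewrite (leq_trans tq) // horner_nat_mono ?leq_addr.
by rewrite (leq_trans sq) // (leq_trans (horner_nat_mono qg yq)) ?leq_addl.
Qed.

(** [MIS_Enum] and [MHS_Enum] are its instances at [MIS] and [MHS], so each reduction is proved once
    for both. *)
Definition listing_problem (G : forall n, {set {set 'I_n}} -> {set {set 'I_n}}) : problem :=
  @Problem {n : nat & {set {set 'I_n}}}
    (fun I => sperner (tagged I))
    (fun I x => code_hypergraph (tagged I) x)
    (fun I y => lists (@enc_set _) (G _ (tagged I)) y).

(** Bounds a list of at most [N + 2] items on at most [n + 3] points, with [n <= N]: an implication
    has size at most [8 * (n + 3) + 3], its list cell adds one, and the final [1] is the closing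
    [Nil]. *)
Definition output_bound : {poly nat} := (('X + 2%:P) * (8%:P * 'X + 28%:P) + 1%:P)%R.

Lemma output_boundE n : output_bound.[n]%R = (n + 2) * (8 * n + 28) + 1.
Proof. by rewrite !(hornerD, hornerM, hornerX, hornerC). Qed.

Lemma dsize_enc_set n (A : {set 'I_n}) : dsize (enc_set A) <= (n * 4).+1.
Proof. by rewrite enc_setE (leq_trans (dsize_enc_bits _)) ?size_bits. Qed.

Lemma dsize_enc_imp n (i : implication 'I_n) : dsize (enc_imp i) <= (n * 8).+3.
Proof.
rewrite ltnS (leq_trans (leq_add (dsize_enc_set i.1) (dsize_enc_set i.2))) //; lia.
Qed.

(** * Reductions to ICS-Enum and ACS-Enum *)

Section Irr.
Variables (n : nat) (H : {set {set 'I_n}}).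

Definition premise_base : {set implication 'I_n.+2} := point_base (apexed H).

Lemma premise_base_height2 :
  represents premise_base (closed_sets premise_base) /\
  height2_geometry (closed_sets premise_base).
Proof.
rewrite /premise_base closed_point_base; have K0 := independent_apexed0 H.
by split; [apply: represents_point_base | apply: height2_geometry_point_base].
Qed.

Lemma code_premise_base s : perm_eq s (enum H) ->
  code_ib premise_base (Cons (enc_nat n.+2)
    (enc_list enc_bits2 (rev (map premise (map (@bits n) s))))).
Proof.
move=> ps; exists (enc_list (@enc_imp _) (rev [seq point_imp (ext true E) | E <- s])); split.
  exists (rev [seq point_imp (ext true E) | E <- s]); split=> //; apply: uniq_perm.
  - rewrite rev_uniq map_inj_uniq ?(perm_uniq ps) ?enum_uniq //.
    by move=> A B /point_imp_inj /ext_injr.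
  - exact: enum_uniq.
  move=> i; rewrite mem_rev mem_enum; apply/mapP/imsetP => [[E Es ->]|[_ /imsetP[E EH ->] ->]].
    by exists (ext true E); rewrite ?imset_f // -mem_enum -(perm_mem ps).
  by exists E; rewrite ?(perm_mem ps) ?mem_enum.
rewrite enc_list_impE map_rev -!map_comp; congr (Cons _ (enc_list _ (rev _))).
by apply: eq_map => E; rewrite /= !bits_ext -ext_set0 bits_ext (bits_set0 E).
Qed.

(** [F] stands for [irr] of the system as well as for [irr_at] at [ord0]: both agree on the sets
    avoiding the implied point, and the remaining sets are filtered out. The size claim says that
    few sets are discarded. *)
Lemma irr_post_correct co (G : {set {set 'I_n}}) (F : {set {set 'I_n.+2}}) s :
  (forall A, (A \in G) = (flip co A \in MIS H)) ->
  F \subset irr (closed_sets premise_base) ->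
  (forall A, (ext false A \in F) = maxset (independent (apexed H)) A) ->
  perm_eq s (enum F) ->
  lists (@enc_set n) G (enc_list enc_bits (rev [seq maybe_compl co (behead (behead b)) |
    b <- map (@bits _) s & irr_kept b])) /\ size s <= #|G| + n.+2.
Proof.
move=> GE sF FE ps.
pose keep (C : {set 'I_n.+2}) := (ord0 \notin C) && (ord0 \in rest C).
pose g (C : {set 'I_n.+2}) := flip co (rest (rest C)).
have pG : perm_eq (rev (map g (filter keep s))) (enum G).
  apply: (perm_filter_map (g' := fun A => ext false (ext true (flip co A)))) ps _ _.
    move=> C; case: (extP C) => z {}C; case: (extP C) => w A.
    rewrite /keep /g !rest_ext !in_ext0 flipK => + /andP[nz wT]; rewrite wT (negbTE nz) FE.
    by rewrite maxset_apexed_true GE flipK.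
  by move=> A; rewrite GE /keep /g FE maxset_apexed_true !rest_ext !in_ext0 flipK.
split.
  exists (rev (map g (filter keep s))); split=> //.
  rewrite enc_list_setE filter_map map_rev -!map_comp.
  congr (enc_list _ (rev _)); have ek : preim (@bits _) irr_kept =1 keep.
    by move=> C; rewrite /= /irr_kept !(head_bits, behead_bits).
  by rewrite (eq_filter ek); apply: eq_map => C; rewrite /= bits_flip !behead_bits.
rewrite -(count_predC keep) leq_add //.
  by rewrite cardE -(perm_size pG) size_rev size_map size_filter.
(* The discarded sets are among the complements of the [n + 1] points other than the implied one,
   and the set lacking exactly the implied point and the apex. *)
pose others := ext false (ext false setT) :: map (@ext _ true) (coatom_sets n.+1).
have so : size others = n.+2.
  by apply: (congr1 S (_ : size (map _ (coatom_sets n.+1)) = n.+1));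
    rewrite size_map size_coatom_sets.
rewrite -size_filter -[X in _ <= X]so; apply: uniq_leq_size.
  by rewrite filter_uniq ?(perm_uniq ps) ?enum_uniq.
move=> C; rewrite mem_filter (perm_mem ps) mem_enum => /andP[nk CF].
have : C \in irr (closed_sets premise_base) by apply: subsetP CF.
rewrite closed_point_base => /irr_pointP[[A maxA eC]|[v ->]];
  rewrite inE; apply/orP; [left | right].
  rewrite {C CF}eC /= /keep rest_ext in_ext0 in nk *.
  case: (extP A) maxA nk => -[] {}A maxA; rewrite in_ext0 //= => _.
  by rewrite (maxset_apexed_false maxA).
by rewrite map_f //; apply/mem_coatom_sets; exists v.
Qed.

End Irr.

Lemma irr_reduction (Q : problem) (f : prog) (co : bool)
    (G : forall n, {set {set 'I_n}} -> {set {set 'I_n}}) (qf : {poly nat}) :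
  (forall n (H : {set {set 'I_n}}) A, (A \in G n H) = (flip co A \in MIS H)) ->
  (forall n (H : {set {set 'I_n}}) x, code_hypergraph H x ->
     exists (J : instance Q) x' t (F : {set {set 'I_n.+2}}),
     [/\ valid J, code J x', eval f x x' t & t <= qf.[dsize x]%R] /\
     [/\ F \subset irr (closed_sets (premise_base H)),
         forall A, (ext false A \in F) = maxset (independent (apexed H)) A &
         forall y, answer J y -> lists (@enc_set _) F y]) ->
  at_least_as_hard Q (listing_problem G).
Proof.
move=> GE red; have [qg tg] := poly_time_irr_post co.
apply: (@at_least_as_hard_by _ _ f (PIrrPost co) qf qg output_bound) => -[n H] x /= _ cx.
have [J [x' [t [F [[vJ cJ ef tq] [sF FE ans]]]]]] := red n H x cx.
exists J, x', t; split=> // y' /ans[s [ps ->]].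
have [u] := tg (map (@bits _) s) I; rewrite -enc_list_setE => eu uq.
have [lG sG] := irr_post_correct (GE n H) sF FE ps.
set y := enc_list enc_bits (rev _) in eu lG; exists y, u; split=> //.
have yG : #|G n H| <= dsize y.
  by case: lG => r [pr ->]; rewrite cardE -(perm_size pr) size_enc_list.
have nx : n <= dsize x.
  by case: cx => l [_ ->]; rewrite /= dsize_enc_nat; lia.
rewrite output_boundE (leq_trans (dsize_enc_list_le (fun A _ => dsize_enc_set A))) //.
by rewrite -addn1 leq_add2r leq_mul ?(leq_trans sG) //; lia.
Qed.

Lemma ICS_Enum_hard co (G : forall n, {set {set 'I_n}} -> {set {set 'I_n}}) :
  (forall n (H : {set {set 'I_n}}) A, (A \in G n H) = (flip co A \in MIS H)) ->
  at_least_as_hard ICS_Enum_height2 (listing_problem G).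
Proof.
move=> GE; have [qf tf] := poly_time_premises.
apply: (@irr_reduction _ PPremises co _ qf GE) => n H x [l [[s [ps ->]] ->]].
have [t et tq] := tf (n, map (@bits n) s) I; rewrite -enc_list_setE in et tq.
exists (existT _ n.+2 (premise_base H)); eexists; exists t, (irr (closed_sets (premise_base H))).
split.
  by split; [exact: premise_base_height2 | exact: code_premise_base ps | exact: et | exact: tq].
split=> // A; rewrite closed_point_base; apply/irr_pointP/idP => [|maxA]; last by left; exists A.
by case=> [[B maxB /ext_injr ->]//|[v /ext_inj[]]].
Qed.

Lemma ACS_Enum_hard co (G : forall n, {set {set 'I_n}} -> {set {set 'I_n}}) :
  (forall n (H : {set {set 'I_n}}) A, (A \in G n H) = (flip co A \in MIS H)) ->
  at_least_as_hard ACS_Enum_height2 (listing_problem G).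
Proof.
(* The distinguished point is [ord0], whose unary code is [Nil]; pairing with [PNil] prepends it. *)
move=> GE; have [qf' tf'] : exists q' : {poly nat}, forall n l, exists2 t,
    eval (PPair PNil PPremises) (Cons (enc_nat n) (enc_list enc_bits l)) (Cons Nil
      (Cons (enc_nat n.+2) (enc_list enc_bits2 (rev (map premise l))))) t &
    t <= q'.[dsize (Cons (enc_nat n) (enc_list enc_bits l))]%R.
  have bx := poly_bounded_size (fun _ : nat * seq (seq bool) => True)
    (fun u => dsize (Cons (enc_nat u.1) (enc_list enc_bits u.2))).
  have := poly_time_pair (poly_time_nil (fun _ _ => erefl) bx) poly_time_premises.
  by case=> q' tq; exists q' => n l; apply: (tq (n, l)).
apply: (@irr_reduction _ (PPair PNil PPremises) co _ qf' GE) => n H x [l [[s [ps ->]] ->]].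
have [t et tq] := tf' n (map (@bits n) s); rewrite -enc_list_setE in et tq.
exists (existT _ n.+2 (premise_base H, ord0)); eexists; exists t,
  (irr_at (closed_sets (premise_base H)) ord0).
split.
  split; [exact: premise_base_height2 | | exact: et | exact: tq].
  by eexists; split; [exact: code_premise_base ps | ].
split=> // [|A]; first exact: bigcup_sup.
by rewrite closed_point_base irr_at_ord0.
Qed.

(** * Reduction to MIB-Gen *)

Section MinBase.
Variables (n : nat) (H : {set {set 'I_n}}).
Hypothesis spH : sperner H.

Definition framed_system : {set {set 'I_n.+3}} := point_system (framed H).

(** The base of height two has the minimal implying sets as premises; it certifies the instance and
    is never computed by the reduction. *)
Lemma framed_system_height2 : closure_system framed_system /\ height2_geometry framed_system.
Proof.
rewrite /framed_system -(point_system_min_implying (@framed_anti n H)).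
have K0 : independent (min_implying (framed H)) set0.
  by rewrite (independent_min_implying (@framed_anti n H)) framed0.
by split; [case: (represents_point_base K0) | apply: height2_geometry_point_base].
Qed.

(** The three blocks differ in their leading bits, so nothing is listed twice, and [maxset_framed]
    matches the first two with the maximal members of [framed H]. *)
Lemma code_framed_system s : perm_eq s (enum H) ->
  code_hypergraph (irr framed_system) (Cons (enc_nat n.+3)
    (enc_list enc_bits (irreducibles n (map (@bits n) s)))).
Proof.
move=> ps; pose t := rev [seq ext false (ext true (ext false (~: E))) | E <- s] ++
  ext false (ext false (ext true setT)) :: rev (map (@ext _ true) (coatom_sets n.+2)).
exists (enc_list (@enc_set _) t); split; last first.
  rewrite enc_list_setE; congr (Cons _ (enc_list _ _)).
  rewrite /irreducibles /t.
  move: (coatom_sets n.+2) (coatoms n.+2) (bits_coatom_sets n.+2) => ca _ <-.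
  rewrite map_cat map_cons !map_rev -!map_comp.
  rewrite !bits_ext bits_setT; congr (rev _ ++ _ :: rev _).
    by apply: eq_map => E; rewrite /= !bits_ext bits_setC.
  by apply: eq_map => A; rewrite /= bits_ext.
exists t; split=> //; apply: uniq_perm; rewrite ?enum_uniq //.
  rewrite cat_uniq; apply/and3P; split.
  - rewrite rev_uniq map_inj_uniq ?(perm_uniq ps) ?enum_uniq // => A B.
    by move=> /ext_injr/ext_injr/ext_injr/setC_inj.
  - apply/hasPn=> C; rewrite inE mem_rev => /predU1P[->|/mapP[A _ ->]]; rewrite /= mem_rev;
      apply/mapP=> -[E _ /ext_inj[//]].
    by move=> _ /ext_inj[].
  - rewrite cons_uniq rev_uniq mem_rev (map_inj_uniq (@ext_injr _ true)) uniq_coatom_sets andbT.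
    by apply/mapP=> -[A _ /ext_inj[]].
move=> C; rewrite mem_enum mem_cat inE !mem_rev.
apply/or3P/irr_pointP => [[/mapP[E Es ->]|/eqP->|/mapP[A /mem_coatom_sets[v ->] ->]]|].
- left; exists (ext true (ext false (~: E))) => //.
  by rewrite maxset_framed // setCK -mem_enum -(perm_mem ps).
- by left; exists (ext false (ext true setT)); rewrite ?maxset_framed ?eqxx.
- by right; exists v.
case=> [[A + ->]|[v ->]]; last first.
  by constructor 3; rewrite map_f //; apply/mem_coatom_sets; exists v.
case: (extP A) => w {}A; case: (extP A) => u {}A; rewrite maxset_framed //.
case: w => /andP[]; case: u => // _; last by move=> /eqP->; constructor 2.
by move=> AH; constructor 1; apply/mapP; exists (~: A); rewrite ?setCK // (perm_mem ps) mem_enum.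
Qed.

(** Whatever unit-minimum base is returned, its premises are the minimal implying sets. Those
    without [u] yield the minimal transversals of [H], and at most one other premise is
    discarded. *)
Lemma premise_post_correct co (G : {set {set 'I_n}}) (S : {set implication 'I_n.+3}) s :
  (forall A, (A \in G) = (flip co A \in MHS H)) ->
  represents S framed_system -> unit_minimum S -> perm_eq s (enum S) ->
  lists (@enc_set n) G (enc_list enc_bits (rev [seq maybe_compl co (behead (behead (behead i.1))) |
    i <- [seq (bits i.1, bits i.2) | i <- s] & premise_kept i])) /\ size s <= #|G| + 1.
Proof.
move=> GE [_ _ clS] minS ps.
have {clS minS} SE := unit_minimum_point_system (@framed_anti n H) minS clS.
pose keep (i : implication 'I_n.+3) := ord0 \notin rest (rest i.1).
pose g (i : implication 'I_n.+3) := flip co (rest (rest (rest i.1))).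
have pG : perm_eq (rev (map g (filter keep s))) (enum G).
  apply: (perm_filter_map (g' := fun A => point_imp (ext true (ext false (flip co A))))) ps _ _.
    move=> i; rewrite SE => /imsetP[B /min_implying_framedP[->|[A AM ->]] ->].
      by rewrite /keep /= !rest_ext in_ext0.
    by rewrite /keep /g /= !rest_ext in_ext0 GE !flipK.
  move=> A; rewrite GE /keep /g SE /= !rest_ext !in_ext0 flipK => AM; split=> //.
  by rewrite imset_f // min_implying_framed_false.
split.
  exists (rev (map g (filter keep s))); split=> //.
  rewrite enc_list_setE filter_map map_rev -!map_comp.
  congr (enc_list _ (rev _)).
  have ek : preim (fun i : implication 'I_n.+3 => (bits i.1, bits i.2)) premise_kept =1 keep.
    by move=> C; rewrite /= /premise_kept !(behead_bits, head_bits).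
  by rewrite (eq_filter ek); apply: eq_map => C; rewrite /= bits_flip !behead_bits.
rewrite -(count_predC keep) leq_add //.
  by rewrite cardE -(perm_size pG) size_rev size_map size_filter.
rewrite -size_filter -[1]/(size [:: point_imp (ext true (ext true (set0 : {set 'I_n})))]).
apply: uniq_leq_size; first by rewrite filter_uniq ?(perm_uniq ps) ?enum_uniq.
move=> i; rewrite mem_filter (perm_mem ps) mem_enum SE => /andP[nk].
case/imsetP=> B /min_implying_framedP[-> -> |[A _ ->] ei]; first by rewrite inE.
by move: nk; rewrite ei /keep /= !rest_ext in_ext0.
Qed.

End MinBase.

Lemma MIB_Gen_hard co (G : forall n, {set {set 'I_n}} -> {set {set 'I_n}}) :
  (forall n (H : {set {set 'I_n}}) A, (A \in G n H) = (flip co A \in MHS H)) ->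
  at_least_as_hard MIB_Gen_height2 (listing_problem G).
Proof.
move=> GE; have [qf tf] := poly_time_irreducibles; have [qg tg] := poly_time_premise_post co.
apply: (@at_least_as_hard_by _ _ PIrreducibles (PPremisePost co) qf qg output_bound).
move=> -[n H] x /= spH [l [[sH [psH ->]] ->]].
have [t et tq] := tf (n, map (@bits n) sH) I; rewrite -enc_list_setE in et tq.
exists (existT _ n.+3 (framed_system H)); eexists; exists t.
split; [exact: framed_system_height2 | exact: code_framed_system psH | exact: et | exact: tq |].
move=> y' [S [rS minS [s [ps ->]]]].
have [u] := tg [seq (bits i.1, bits i.2) | i <- s] I; rewrite -enc_list_impE => eu uq.
have [lG sG] := premise_post_correct (GE n H) rS minS ps.
set y := enc_list enc_bits (rev _) in eu lG; exists y, u; split=> //.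
have yG : #|G n H| <= dsize y.
  by case: lG => r [pr ->]; rewrite cardE -(perm_size pr) size_enc_list.
have nx : n <= dsize (Cons (enc_nat n) (enc_list (@enc_set n) sH)).
  by rewrite /= dsize_enc_nat; lia.
move: (dsize (Cons _ _)) nx => dx nx.
rewrite output_boundE (leq_trans (dsize_enc_list_le (fun i _ => @dsize_enc_imp n.+3 i))) //.
by rewrite -addn1 leq_add2r leq_mul ?(leq_trans sG) //; lia.
Qed.

Theorem theorem17 :
  (at_least_as_hard ICS_Enum_height2 MIS_Enum /\
   at_least_as_hard ACS_Enum_height2 MIS_Enum /\
   at_least_as_hard MIB_Gen_height2 MIS_Enum) /\
  (at_least_as_hard ICS_Enum_height2 MHS_Enum /\
   at_least_as_hard ACS_Enum_height2 MHS_Enum /\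
   at_least_as_hard MIB_Gen_height2 MHS_Enum).
Proof.
have MHSE n (H : {set {set 'I_n}}) A : (A \in MHS H) = (flip true A \in MIS H).
  exact: MHS_setC.
have MISE n (H : {set {set 'I_n}}) A : (A \in MIS H) = (flip true A \in MHS H).
  by rewrite MHSE flipK.
split; split.
(* The flag is [false] exactly where the family is read directly: maximal independent sets for
   ICS-Enum and ACS-Enum, minimal transversals for MIB-Gen. *)
- exact: (@ICS_Enum_hard false (fun n => @MIS 'I_n)).
- by split; [exact: (@ACS_Enum_hard false (fun n => @MIS 'I_n))
            | exact: (@MIB_Gen_hard true (fun n => @MIS 'I_n))].
- exact: (@ICS_Enum_hard true (fun n => @MHS 'I_n)).
- by split; [exact: (@ACS_Enum_hard true (fun n => @MHS 'I_n))
            | exact: (@MIB_Gen_hard false (fun n => @MHS 'I_n))].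
Qed.
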